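(* The equational classes (categories) $\mathcal{F}_p$ of pointed F-quasigroups and $\mathcal{M}_n$ of nuclearly pointed generalized $\mathbf{R}$-modules in $\mathcal{M}$ are equivalent. Moreover, the equivalence restricts to an equivalence between $\mathcal{F}_m$ and $\mathcal{M}_c$. Here $\mathcal{F}_p$, $\mathcal{F}_m$, $\mathbf{R}$, $\mathcal{M}$, $\mathcal{M}_n$, $\mathcal{M}_c$ are as defined in the context.
   Context: Quasigroups. A quasigroup $(Q,\cdot)$ is a set with a binary operation (juxtaposition) such that for all $a,b\in Q$ the equations $ax=b$ and $ya=b$ have unique solutions $x,y\in Q$. Let $\alpha,\beta:Q\to Q$ be the maps determined by $x\,\alpha(x)=x=\beta(x)\,x$. $(Q,\cdot)$ is an F-quasigroup if $x\cdot yz = xy\cdot \alpha(x)z$ and $zy\cdot x = z\beta(x)\cdot yx$ for all $x,y,z\in Q$. Put $M(Q)=\{a\in Q: xa\cdot yx = xy\cdot ax\ \forall x,y\in Q\}$. $\mathcal{F}_p$ is the equational class (and category) of pointed F-quasigroups: pairs $(Q,a)$ with $Q$ an F-quasigroup and $a\in Q$; morphisms are quasigroup homomorphisms preserving the distinguished element. $\mathcal{F}_m=\{(Q,a)\in\mathcal{F}_p: a\in M(Q)\}$. Loops. A loop is a quasigroup with a neutral element; loops are written additively $(Q,+)$ with neutral element $0$, with $+$ not assumed commutative or associative. The nucleus $N(Q,+)$ is the set of $a\in Q$ with $(a+x)+y=a+(x+y)$, $(x+a)+y=x+(a+y)$, $(x+y)+a=x+(y+a)$ for all $x,y\in Q$.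 The Moufang center is $K(Q,+)=\{a\in Q:(a+a)+(x+y)=(a+x)+(a+y)\ \forall x,y\in Q\}$. The center is $Z(Q,+)=N(Q,+)\cap K(Q,+)$. $(Q,+)$ is an NK-loop if every $x\in Q$ can be written $x=u+v\;(=v+u)$ with $u\in N(Q,+)$, $v\in K(Q,+)$. NK-loops are diassociative (any two elements generate a group), so integer multiples $mx$ ($m\in\mathbb{Z}$) are unambiguous. Generalized modules. Let $R$ be an associative ring, possibly without unity. A generalized (left) $R$-module is an NK-loop $(Q,+)$ with a scalar multiplication $R\times Q\to Q$ such that for all $a,b\in R$, $x,y\in Q$, $z\in N(Q,+)$, $w\in K(Q,+)$: (1) $a(x+y)=ax+ay$; (2) $(a+b)x=ax+bx$; (3) $a(bx)=(ab)x$; (4) $ax\in K(Q,+)$; (5) $az\in N(Q,+)$; (6) there exists an integer $m$ such that $mw+aw\in Z(Q,+)$. Put $\mathrm{Ann}(Q)=\{a\in R: aQ=0\}$. The ring $\mathbf{R}$. Let $\mathbf{S}=\mathbb{Z}[\mathbf{x},\mathbf{y},\mathbf{u},\mathbf{v}]$ be the polynomial ring in four commuting indeterminates and let $\mathbf{R}=\mathbf{S}\mathbf{x}+\mathbf{S}\mathbf{y}+\mathbf{S}\mathbf{u}+\mathbf{S}\mathbf{v}$ be the ideal generated by the indeterminates, regarded as a commutative associative ring without unity. $\mathcal{M}$ is the equational class (and category) of generalized $\mathbf{R}$-modules $Q$ such that: (1) $2z+\mathbf{x}z\in N(Q,+)$ and $2z+\mathbf{y}z\in N(Q,+)$ for all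 $z\in Q$; (2) $\mathbf{x}+\mathbf{u}+\mathbf{x}\mathbf{u}\in\mathrm{Ann}(Q)$; (3) $\mathbf{y}+\mathbf{v}+\mathbf{y}\mathbf{v}\in\mathrm{Ann}(Q)$. $\mathcal{M}_p$ is the class (and category) of pairs $(Q,e)$ with $Q\in\mathcal{M}$ and $e\in Q$; morphisms are loop homomorphisms commuting with the $\mathbf{R}$-scalar multiplication and preserving the distinguished element. $\mathcal{M}_n=\{(Q,e)\in\mathcal{M}_p: e\in N(Q,+)\}$ and $\mathcal{M}_c=\{(Q,e)\in\mathcal{M}_p: e\in Z(Q,+)\}$. $\mathcal{F}_m$, $\mathcal{M}_n$ and $\mathcal{M}_c$ are regarded as full subcategories of $\mathcal{F}_p$, $\mathcal{M}_p$ and $\mathcal{M}_p$ respectively, and ''equivalent'' means equivalent as categories. *)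

(* Defs.v *)
From HB Require Import structures.
From mathcomp Require Import all_boot all_algebra.
From mathcomp Require Import boolp.
From mathcomp Require Import mpoly.

Set Implicit Arguments.
Unset Strict Implicit.
Unset Printing Implicit Defensive.

Import GRing.Theory.

Local Open Scope ring_scope.

Record category := Category {
  ob :> Type;
  hom : ob -> ob -> Type;
  idm : forall X, hom X X;
  comp : forall X Y Z, hom Y Z -> hom X Y -> hom X Z;
  comp_idl : forall X Y (f : hom X Y), comp (idm Y) f = f;
  comp_idr : forall X Y (f : hom X Y), comp f (idm X) = f;
  compA : forall X Y Z T (h : hom Z T) (g : hom Y Z) (f : hom X Y),
    comp h (comp g f) = comp (comp h g) f }.

Arguments hom {c}.
Arguments idm {c}.
Arguments comp {c X Y Z}.

Record functor (C D : category) := Functor {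
  fob :> C -> D;
  fhom : forall X Y : C, hom X Y -> hom (fob X) (fob Y);
  fhom_id : forall X : C, fhom (idm X) = idm (fob X);
  fhom_comp : forall (X Y Z : C) (g : hom Y Z) (f : hom X Y),
    fhom (comp g f) = comp (fhom g) (fhom f) }.

Arguments fhom {C D} _ {X Y}.

Definition functor_id (C : category) : functor C C :=
  @Functor C C id (fun _ _ f => f) (fun=> erefl) (fun _ _ _ _ _ => erefl).

Section FunctorComp.
Variables (C D E : category) (G : functor D E) (F : functor C D).

Let gf_id (X : C) : fhom G (fhom F (idm X)) = idm (G (F X)).
Proof. by rewrite !fhom_id. Qed.

Let gf_comp (X Y Z : C) (g : hom Y Z) (f : hom X Y) :
  fhom G (fhom F (comp g f)) = comp (fhom G (fhom F g)) (fhom G (fhom F f)).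
Proof. by rewrite !fhom_comp. Qed.

Definition functor_comp : functor C E :=
  @Functor C E (fun X => G (F X)) (fun X Y f => fhom G (fhom F f))
    gf_id gf_comp.
End FunctorComp.

Definition is_iso (C : category) (X Y : C) (f : hom X Y) : Prop :=
  exists g : hom Y X, comp g f = idm X /\ comp f g = idm Y.

Definition naturally_isomorphic (C D : category) (F G : functor C D) : Prop :=
  exists eta : forall X : C, hom (F X) (G X),
    (forall (X Y : C) (f : hom X Y),
        comp (eta Y) (fhom F f) = comp (fhom G f) (eta X)) /\
    (forall X : C, is_iso (eta X)).

Definition mutually_inverse_equivalences (C D : category)
    (F : functor C D) (G : functor D C) : Prop :=
  naturally_isomorphic (functor_comp G F) (functor_id C) /\
  naturally_isomorphic (functor_comp F G) (functor_id D).

Definition full_subcategory (C : category) (P : C -> Prop) : category :=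
  @Category {X : C | P X} (fun X Y => hom (sval X) (sval Y))
    (fun X => idm (sval X)) (fun X Y Z g f => comp g f)
    (fun X Y f => comp_idl f) (fun X Y f => comp_idr f)
    (fun X Y Z T h g f => compA h g f).

Section FullSubcategoryFunctors.
Variables (C D : category).

Definition full_incl (P : C -> Prop) : functor (full_subcategory P) C :=
  @Functor (full_subcategory P) C (fun X => sval X) (fun _ _ f => f)
    (fun=> erefl) (fun _ _ _ _ _ => erefl).

Definition corestrict (F : functor C D) (P : D -> Prop)
    (FP : forall X, P (F X)) : functor C (full_subcategory P) :=
  @Functor C (full_subcategory P) (fun X => exist P (F X) (FP X))
    (fun X Y f => fhom F f) (fun X => fhom_id F X)
    (fun X Y Z g f => fhom_comp F g f).
End FullSubcategoryFunctors.

Arguments corestrict {C D} F {P} FP.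

Definition uniquely_divisible (Q : Type) (op : Q -> Q -> Q) : Prop :=
  (forall a b, exists! x, op a x = b) /\ (forall a b, exists! y, op y a = b).

HB.mixin Record Magma_isQuasigroup Q of Magma Q := {
  mulg_divisible : uniquely_divisible (@monoid.mul Q)
}.

#[short(type="quasigroupType")]
HB.structure Definition Quasigroup := {Q of Magma_isQuasigroup Q & Magma Q}.

Section LocalUnits.
Variable Q : quasigroupType.
Implicit Types x : Q.

Definition alpha x : Q := sval (cid ((@mulg_divisible Q).1 x x)).
Definition beta x : Q := sval (cid ((@mulg_divisible Q).2 x x)).

Lemma mulg_alpha x : (x * alpha x)%g = x.
Proof. by rewrite /alpha; case: cid => y []. Qed.

Lemma mulg_beta x : (beta x * x)%g = x.
Proof. by rewrite /beta; case: cid => y []. Qed.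
End LocalUnits.

HB.mixin Record Quasigroup_isFQuasigroup Q of Quasigroup Q := {
  mulg_Fl : forall x y z : Q, (x * (y * z) = (x * y) * (alpha x * z))%g;
  mulg_Fr : forall x y z : Q, ((z * y) * x = (z * beta x) * (y * x))%g
}.

#[short(type="fquasigroupType")]
HB.structure Definition FQuasigroup :=
  {Q of Quasigroup_isFQuasigroup Q & Quasigroup Q}.

Definition Mset (Q : quasigroupType) (a : Q) : Prop :=
  forall x y : Q, ((x * a) * (y * x) = (x * y) * (a * x))%g.

Record pointed_fquasigroup := PointedFQuasigroup {
  fq_sort :> fquasigroupType;
  fq_point : fq_sort }.

Record fq_hom (X Y : pointed_fquasigroup) := FQHom {
  fq_fun :> X -> Y;
  fq_funM : {morph fq_fun : x y / (x * y)%g};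
  fq_fun_point : fq_fun (fq_point X) = fq_point Y }.

Lemma fq_hom_eq X Y (f g : fq_hom X Y) : fq_fun f = fq_fun g -> f = g.
Proof.
case: f g => [f fM fp] [g gM gp] /= fg; move: fM fp; rewrite fg => fM fp.
by rewrite (Prop_irrelevance fM gM) (Prop_irrelevance fp gp).
Qed.

Definition fq_id X : fq_hom X X :=
  @FQHom X X id (fun _ _ => erefl) erefl.

Section FQComp.
Variables (X Y Z : pointed_fquasigroup) (g : fq_hom Y Z) (f : fq_hom X Y).

Let gfM : {morph (g \o f) : x y / (x * y)%g}.
Proof. by move=> x y /=; rewrite !fq_funM. Qed.

Let gf_point : (g \o f) (fq_point X) = fq_point Z.
Proof. by rewrite /= !fq_fun_point. Qed.

Definition fq_comp : fq_hom X Z := FQHom gfM gf_point.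
End FQComp.

Definition Fp : category :=
  @Category pointed_fquasigroup fq_hom fq_id fq_comp
    (fun X Y f => fq_hom_eq (f := fq_comp (fq_id Y) f) (g := f) erefl)
    (fun X Y f => fq_hom_eq (f := fq_comp f (fq_id X)) (g := f) erefl)
    (fun X Y Z T h g f => fq_hom_eq (f := fq_comp h (fq_comp g f))
                            (g := fq_comp (fq_comp h g) f) erefl).

Definition M_pointed (X : Fp) : Prop := Mset (fq_point X).

Definition Fm : category := full_subcategory M_pointed.

HB.mixin Record BaseAddUMagma_isLoop Q of Algebra.BaseAddUMagma Q := {
  loop_add0 : left_id (0 : Q) +%R;
  loop_addr0 : right_id (0 : Q) +%R;
  loop_divisible : uniquely_divisible (@Algebra.add Q)
}.

#[short(type="loopType")]
HB.structure Definition Loop :=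
  {Q of BaseAddUMagma_isLoop Q & Algebra.BaseAddUMagma Q}.

Section LoopTheory.
Variable Q : loopType.
Implicit Types a x y : Q.

Definition nucleus a : Prop :=
  forall x y, [/\ (a + x) + y = a + (x + y),
                  (x + a) + y = x + (a + y)
                & (x + y) + a = x + (y + a)].

Definition moufang_center a : Prop :=
  forall x y, (a + a) + (x + y) = (a + x) + (a + y).

Definition center a : Prop := nucleus a /\ moufang_center a.

(* The right inverse; in an NK-loop it is two-sided, by diassociativity. *)
Definition loop_opp x : Q := sval (cid ((@loop_divisible Q).1 x 0)).

Lemma loop_addN x : x + loop_opp x = 0.
Proof. by rewrite /loop_opp; case: cid => y []. Qed.

(* Multiples are bracketed to the right, as in [x *+ n]; diassociativity makes
   the bracketing irrelevant in an NK-loop. *)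
Definition loop_mulz (m : int) x : Q :=
  match m with Posz n => x *+ n | Negz n => loop_opp x *+ n.+1 end.
End LoopTheory.

(* The relation [u + v = v + u] need not be required: [v] in the Moufang center
   commutes with every element (take [x := 0], resp. [y := 0], in its
   definition). *)
HB.mixin Record Loop_isNKLoop Q of Loop Q := {
  NK_decomposition : forall x : Q,
    exists u v : Q, [/\ nucleus u, moufang_center v & x = u + v]
}.

#[short(type="nkloopType")]
HB.structure Definition NKLoop := {Q of Loop_isNKLoop Q & Loop Q}.

(* Associative rings, possibly without unity; the product is [(a * b)%g]. *)
HB.mixin Record Zmodule_Semigroup_isRng R
    of GRing.Zmodule R & Semigroup R := {
  rng_mulDl : left_distributive (@monoid.mul R) (+%R : R -> R -> R);
  rng_mulDr : right_distributive (@monoid.mul R) (+%R : R -> R -> R)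
}.

#[short(type="rngType")]
HB.structure Definition Rng :=
  {R of Zmodule_Semigroup_isRng R & GRing.Zmodule R & Semigroup R}.

Reserved Notation "a *> x" (at level 40, left associativity).

HB.mixin Record NKLoop_isGModule (R : rngType) Q of NKLoop Q := {
  gscale : R -> Q -> Q;
  gscaleDr : forall a (x y : Q), gscale a (x + y) = gscale a x + gscale a y;
  gscaleDl : forall (a b : R) x, gscale (a + b) x = gscale a x + gscale b x;
  gscaleA : forall (a b : R) x, gscale a (gscale b x) = gscale (a * b)%g x;
  gscale_moufang_center : forall a x, moufang_center (gscale a x);
  gscale_nucleus : forall a z, nucleus z -> nucleus (gscale a z);
  gscale_center : forall a w, moufang_center w ->
    exists m : int, center (loop_mulz m w + gscale a w)
}.

#[short(type="gmodType")]
HB.structure Definition GModule (R : rngType) :=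
  {Q of NKLoop_isGModule R Q & NKLoop Q}.

Notation "a *> x" := (gscale a x) : ring_scope.

Definition Ann (R : rngType) (Q : gmodType R) (a : R) : Prop :=
  forall x : Q, a *> x = 0.

Definition polyS := {mpoly int[4]}.

Definition Sx : polyS := 'X_(@Ordinal 4 0 isT).
Definition Sy : polyS := 'X_(@Ordinal 4 1 isT).
Definition Su : polyS := 'X_(@Ordinal 4 2 isT).
Definition Sv : polyS := 'X_(@Ordinal 4 3 isT).

Definition idealR : pred polyS := fun p =>
  `[< exists a b c d : polyS, p = a * Sx + b * Sy + c * Su + d * Sv >].

Lemma idealR_zmod_closed : zmod_closed idealR.
Proof.
split=> [|p q /asboolP[a [b [c [d ->]]]] /asboolP[a' [b' [c' [d' ->]]]]].
  by apply/asboolP; exists 0, 0, 0, 0; rewrite !mul0r !addr0.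
apply/asboolP; exists (a - a'), (b - b'), (c - c'), (d - d').
rewrite !mulrBl !opprD addrACA [X in X + _]addrACA.
by rewrite [X in X + _ + _]addrACA.
Qed.

HB.instance Definition _ :=
  GRing.isZmodClosed.Build polyS idealR idealR_zmod_closed.

Lemma idealR_mull (p q : polyS) : q \in idealR -> p * q \in idealR.
Proof.
move=> /asboolP[a [b [c [d ->]]]]; apply/asboolP.
by exists (p * a), (p * b), (p * c), (p * d); rewrite !mulrDr !mulrA.
Qed.

Record Rring := MkR { R_val : polyS; R_valP : R_val \in idealR }.

HB.instance Definition _ := [isSub for R_val].
HB.instance Definition _ := [Choice of Rring by <:].
HB.instance Definition _ := [SubChoice_isSubZmodule of Rring by <:].

Definition R_mul (p q : Rring) : Rring :=
  MkR (idealR_mull (R_val p) (R_valP q)).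

Lemma R_mulA : associative R_mul.
Proof. by move=> p q r; apply: val_inj; rewrite /= mulrA. Qed.

HB.instance Definition _ := isSemigroup.Build Rring R_mulA.

Lemma R_mulDl : left_distributive R_mul +%R.
Proof. by move=> p q r; apply: val_inj; rewrite /= mulrDl. Qed.

Lemma R_mulDr : right_distributive R_mul +%R.
Proof. by move=> p q r; apply: val_inj; rewrite /= mulrDr. Qed.

HB.instance Definition _ :=
  Zmodule_Semigroup_isRng.Build Rring R_mulDl R_mulDr.

Lemma Sx_ideal : Sx \in idealR.
Proof.
by apply/asboolP; exists 1, 0, 0, 0; rewrite !mul0r mul1r !addr0.
Qed.

Lemma Sy_ideal : Sy \in idealR.
Proof.
by apply/asboolP; exists 0, 1, 0, 0; rewrite !mul0r mul1r !addr0 add0r.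
Qed.

Lemma Su_ideal : Su \in idealR.
Proof.
by apply/asboolP; exists 0, 0, 1, 0; rewrite !mul0r mul1r !addr0 add0r.
Qed.

Lemma Sv_ideal : Sv \in idealR.
Proof.
by apply/asboolP; exists 0, 0, 0, 1; rewrite !mul0r mul1r !add0r.
Qed.

Definition Rx : Rring := MkR Sx_ideal.
Definition Ry : Rring := MkR Sy_ideal.
Definition Ru : Rring := MkR Su_ideal.
Definition Rv : Rring := MkR Sv_ideal.

Definition inM (Q : gmodType Rring) : Prop :=
  [/\ forall z : Q, nucleus (loop_mulz 2 z + Rx *> z)
                    /\ nucleus (loop_mulz 2 z + Ry *> z),
      Ann Q (Rx + Ru + (Rx * Ru)%g)
    & Ann Q (Ry + Rv + (Ry * Rv)%g)].

Record pointed_module := PointedModule {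
  pm_sort :> gmodType Rring;
  pm_inM : inM pm_sort;
  pm_point : pm_sort }.

Record pm_hom (X Y : pointed_module) := PMHom {
  pm_fun :> X -> Y;
  pm_funD : {morph pm_fun : x y / x + y};
  pm_funZ : forall a : Rring, {morph pm_fun : x / a *> x};
  pm_fun_point : pm_fun (pm_point X) = pm_point Y }.

Lemma pm_hom_eq X Y (f g : pm_hom X Y) : pm_fun f = pm_fun g -> f = g.
Proof.
case: f g => [f fD fZ fp] [g gD gZ gp] /= fg.
move: fD fZ fp; rewrite fg => fD fZ fp.
by rewrite (Prop_irrelevance fD gD) (Prop_irrelevance fZ gZ)
           (Prop_irrelevance fp gp).
Qed.

Definition pm_id X : pm_hom X X :=
  @PMHom X X id (fun _ _ => erefl) (fun _ _ => erefl) erefl.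

Section PMComp.
Variables (X Y Z : pointed_module) (g : pm_hom Y Z) (f : pm_hom X Y).

Let gfD : {morph (g \o f) : x y / x + y}.
Proof. by move=> x y /=; rewrite !pm_funD. Qed.

Let gfZ (a : Rring) : {morph (g \o f) : x / a *> x}.
Proof. by move=> x /=; rewrite !pm_funZ. Qed.

Let gf_point : (g \o f) (pm_point X) = pm_point Z.
Proof. by rewrite /= !pm_fun_point. Qed.

Definition pm_comp : pm_hom X Z := PMHom gfD gfZ gf_point.
End PMComp.

Definition Mp : category :=
  @Category pointed_module pm_hom pm_id pm_comp
    (fun X Y f => pm_hom_eq (f := pm_comp (pm_id Y) f) (g := f) erefl)
    (fun X Y f => pm_hom_eq (f := pm_comp f (pm_id X)) (g := f) erefl)
    (fun X Y Z T h g f => pm_hom_eq (f := pm_comp h (pm_comp g f))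
                            (g := pm_comp (pm_comp h g) f) erefl).

Definition nuclearly_pointed (X : Mp) : Prop := nucleus (pm_point X).
Definition centrally_pointed (X : Mp) : Prop := center (pm_point X).

Definition Mn : category := full_subcategory nuclearly_pointed.
Definition Mc : category := full_subcategory centrally_pointed.

Definition incl_Fm : functor Fm Fp := full_incl M_pointed.
Definition incl_Mn : functor Mn Mp := full_incl nuclearly_pointed.
Definition incl_Mc : functor Mc Mp := full_incl centrally_pointed.

Definition incl_Mc_Mn : functor Mc Mn :=
  corestrict incl_Mc (fun X : Mc => (proj2_sig X).1).

(* Main.v *)
Require Import Defs.
From HB Require Import structures.
From mathcomp Require Import all_boot all_algebra.
From mathcomp Require Import boolp.
From mathcomp Require Import mpoly.

Set Implicit Arguments.
Unset Strict Implicit.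
Unset Printing Implicit Defensive.

Import GRing.Theory.

Local Open Scope ring_scope.

(** An F-quasigroup [Q] pointed by [a] is linear over a loop. The isotope
    [x + y = (x / alpha a) (a \ y)] has neutral element [a]; the right
    translation [f] by [alpha a] and the left translation [g] by [beta a] are
    commuting automorphisms of it, and [x y = f x + (e + g y)] with [e = a a].

    In this loop the two F-laws are the two families of autotopisms
    [p + (x + y) = (f p + x) + (h p + y)] and
    [(x + y) + q = (x + k q) + (y + g q)], where [f p + h p = p] and
    [k q + g q = q]. The first one alone implies that the maps [asc u w], which
    measure the failure of [u + (w + x) = (u + w) + x], are automorphisms
    unchanged when [u] and [w] are replaced by their images under [f] or [h]
    ([ls_asc_automorphism]), and that middle nuclear elements are left nuclear
    ([middle_left_nucleus]). With both laws the middle nucleus is the nucleus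
    [N], and a third autotopism, [mul_alphar], shows that [f] and [k], hence also
    [g] and [h], agree up to [N]. Comparing the two readings of [x + q] then
    makes [asc x q] fix [q] ([asc_fix_r]), so the loop is alternative and [h Q]
    commutes with all of [Q] ([sp_hC]). On [h Q] the maps [f] and [h] differ by
    central elements, so that the first law becomes the Moufang law
    ([sp_moufang_h]): [h Q] lies in the Moufang center [K], and [Q = h Q + N] is
    an NK-loop. As threefold multiples of elements of [K] are central
    ([mc_triple_center]), [f] and [g] are, up to central elements, the identity
    on [N] and the inversion on [K] ([splitting_arith_left],
    [splitting_arith_right]). Conversely such automorphisms give back the two
    families of autotopisms ([ar_left_splitting], [ar_right_splitting]) and
    thereby the F-laws ([linear_mul_left_F]).

    The scalars [x], [y], [u], [v] act on the loop as [- z + p z] for [p] the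
    automorphisms [f], [g] and their inverses. Maps of this kind can be added and
    composed, and their bicommutant is a commutative ring; adjoining a unit to
    it, polynomials can be evaluated there, and those in the ideal act on the
    loop. Conversely [f] and [g] are read off a module as [z + x z] and
    [z + y z]. Both constructions keep the underlying set, and the identity maps
    are the unit and the counit of the equivalence. Finally [a] belongs to
    [M(Q)] exactly when [e] is central ([linear_mul_central]). *)

(** * Loops and their associator maps *)

Section LoopBasics.
Variable Q : loopType.
Implicit Types x y z : Q.

Lemma ladd0 x : 0 + x = x.
Proof. exact: loop_add0. Qed.

Lemma laddr0 x : x + 0 = x.
Proof. exact: loop_addr0. Qed.

Lemma laddI x y z : x + y = x + z -> y = z.
Proof.
move=> e; have [t [_ tU]] := (@loop_divisible Q).1 x (x + z).
by rewrite -(tU _ e) -(tU z erefl).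
Qed.

Lemma laddrI x y z : y + x = z + x -> y = z.
Proof.
move=> e; have [t [_ tU]] := (@loop_divisible Q).2 x (z + x).
by rewrite -(tU _ e) -(tU z erefl).
Qed.

Definition ldiv x y : Q := sval (cid ((@loop_divisible Q).1 x y)).

Lemma addldiv x y : x + ldiv x y = y.
Proof. by rewrite /ldiv; case: cid => z []. Qed.

Lemma ldivP x y : exists z, x + z = y.
Proof. by exists (ldiv x y); exact: addldiv. Qed.

Lemma rdivP x y : exists z, z + x = y.
Proof. by have [z [e _]] := (@loop_divisible Q).2 x y; exists z. Qed.

Definition middle_nucleus n := forall x y, (x + n) + y = x + (n + y).
Definition left_nucleus n := forall x y, (n + x) + y = n + (x + y).
Definition right_nucleus n := forall x y, (x + y) + n = x + (y + n).

Lemma nucleusP n :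
  nucleus n <-> [/\ left_nucleus n, middle_nucleus n & right_nucleus n].
Proof.
split=> [nn | [nl nm nr]] ; first by split=> x y; case: (nn x y).
by move=> x y; split.
Qed.

Lemma nucl n : nucleus n -> left_nucleus n.
Proof. by case/nucleusP. Qed.
Lemma nucm n : nucleus n -> middle_nucleus n.
Proof. by case/nucleusP. Qed.
Lemma nucr n : nucleus n -> right_nucleus n.
Proof. by case/nucleusP. Qed.

(** The inner map measuring the failure of associativity: it is the identity
    exactly when left translation by [u + w] is the composite of those by [u]
    and [w]. *)
Definition asc u w x : Q := ldiv (u + w) (u + (w + x)).

Lemma ascE u w x : (u + w) + asc u w x = u + (w + x).
Proof. exact: addldiv. Qed.

Lemma ascP u w x t : (u + w) + t = u + (w + x) -> asc u w x = t.
Proof. by move=> e; apply: (@laddI (u + w)); rewrite ascE. Qed.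

End LoopBasics.

(** One F-law is the other one for the opposite loop, which yields half of the
    arguments by symmetry. *)
Definition oploop (Q : loopType) : Type := Q.

Section OpLoop.
Variable Q : loopType.

Let opadd (x y : oploop Q) : oploop Q := (y : Q) + (x : Q).

HB.instance Definition _ := Algebra.hasAdd.Build (oploop Q) opadd.
HB.instance Definition _ := Algebra.hasZero.Build (oploop Q) (0 : Q).

Let op0 : left_id (0 : oploop Q) +%R.
Proof. exact: loop_addr0. Qed.
Let opr0 : right_id (0 : oploop Q) +%R.
Proof. exact: loop_add0. Qed.
Let opdiv : uniquely_divisible (@Algebra.add (oploop Q)).
Proof. by have [dl dr] := @loop_divisible Q; split=> a b; [apply: dr|apply: dl]. Qed.

HB.instance Definition _ := BaseAddUMagma_isLoop.Build (oploop Q) op0 opr0 opdiv.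
End OpLoop.

(** One F-law, as a family of autotopisms indexed by [p]; [h p] is what remains
    of [p] after [f p]. *)
Record left_splitting (Q : loopType) (f h : Q -> Q) : Prop := LeftSplitting {
  ls_morph : {morph f : x y / x + y};
  ls_bij : bijective f;
  ls_split : forall p x y, p + (x + y) = (f p + x) + (h p + y) }.

(** * Consequences of one F-law *)

Section LeftSplitting.
Variables (Q : loopType) (f h : Q -> Q).
Hypothesis H : left_splitting f h.
Implicit Types u w x y n m : Q.

Let fD := ls_morph H.
Let A := ls_split H.

Lemma ls_f0 : f 0 = 0.
Proof. by apply: (@laddI _ (f 0)); rewrite -fD !laddr0. Qed.

Lemma ls_fh p : f p + h p = p.
Proof. by have := A p 0 0; rewrite !laddr0. Qed.

Lemma ls_f_addl p y : f p + (h p + y) = p + y.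
Proof. by have := A p 0 y; rewrite ladd0 laddr0. Qed.

Lemma ls_f_addr p x : (f p + x) + h p = p + x.
Proof. by have := A p x 0; rewrite !laddr0. Qed.

(** The autotopisms belonging to [u], [w] and [u + w] combine to one whose first
    and third components fix [0]. This forces its three components, the maps
    [asc] of [f u, f w], of [h u, h w] and of [u, w], to be the same
    automorphism. *)
Lemma ls_asc_automorphism u w :
  [/\ h (u + w) = h u + h w,
      forall x, asc u w x = asc (f u) (f w) x,
      forall x, asc u w x = asc (h u) (h w) x
    & {morph asc u w : x y / x + y}].
Proof.
have s0 a b : asc a b 0 = 0 :> Q by apply: ascP; rewrite !laddr0.
pose V y := ldiv (h (u + w)) (h u + (h w + y)).
have VE y : h (u + w) + V y = h u + (h w + y) by apply: addldiv.
have key x y : asc u w (x + y) = asc (f u) (f w) x + V y.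
  by apply: ascP; rewrite A fD ascE VE A -!A.
have V0 : V 0 = 0 by have := key 0 0; rewrite ladd0 !s0 ladd0.
have hD : h (u + w) = h u + h w by have := VE 0; rewrite V0 !laddr0.
have Vs y : V y = asc (h u) (h w) y.
  by apply/esym/ascP; rewrite -hD VE.
have e1 x : asc u w x = asc (f u) (f w) x by rewrite -{1}(laddr0 x) key V0 laddr0.
have e2 x : asc u w x = asc (h u) (h w) x by rewrite -{1}(ladd0 x) key s0 ladd0 Vs.
by split=> // x y; rewrite key -e1 Vs -e2.
Qed.

Lemma ls_hD : {morph h : u w / u + w}.
Proof. by move=> u w; case: (ls_asc_automorphism u w). Qed.

Lemma ls_h0 : h 0 = 0.
Proof. by have := ls_fh 0; rewrite ls_f0 ladd0. Qed.

Lemma asc_f u w x : asc (f u) (f w) x = asc u w x.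
Proof. by case: (ls_asc_automorphism u w). Qed.

Lemma asc_h u w x : asc (h u) (h w) x = asc u w x.
Proof. by case: (ls_asc_automorphism u w). Qed.

Lemma ascD u w : {morph asc u w : x y / x + y}.
Proof. by case: (ls_asc_automorphism u w). Qed.

Lemma asc_morph (p : Q -> Q) u w x : {morph p : x y / x + y} ->
  p (asc u w x) = asc (p u) (p w) (p x).
Proof. by move=> pD; apply/esym/ascP; rewrite -!pD ascE. Qed.

(** The left translations by [h u] and [f w] commute up to [asc u w]: factor
    [u + (w + y)] through [f u], [h u], [f w], [h w] on the one hand, and
    through [f (u + w)], [h (u + w)] on the other. *)
Lemma ls_swap u w x z : asc u w z = h u + x -> h u + (f w + x) = f w + z.
Proof.
move=> zE; have [y xE] := ldivP (h w) x; apply: (@laddI _ (f u)).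
rewrite ls_f_addl -xE ls_f_addl -(ascE (f u)) asc_f zE -fD.
by rewrite -xE -(ascE (h u)) -ls_hD ls_f_addl asc_h ascE.
Qed.

Lemma middle_nucleusE n : middle_nucleus n <-> forall x y, asc x n y = y.
Proof.
by split=> nn x y; [apply: ascP | rewrite -[RHS]ascE nn].
Qed.

Lemma left_nucleusE n : left_nucleus n <-> forall x y, asc n x y = y.
Proof.
by split=> nn x y; [apply: ascP | rewrite -[RHS]ascE nn].
Qed.

Lemma middle_nucleus_f n : middle_nucleus n <-> middle_nucleus (f n).
Proof.
have [f' fK f'K] := ls_bij H.
rewrite !middle_nucleusE; split=> nn x y.
  by rewrite -(f'K x) asc_f nn.
by rewrite -asc_f nn.
Qed.

Lemma middle_nucleus_hP n : middle_nucleus (h n) -> middle_nucleus n.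
Proof. by rewrite !middle_nucleusE => nn x y; rewrite -asc_h nn. Qed.

Lemma middle_nucleus_h n : middle_nucleus n -> middle_nucleus (h n).
Proof.
move=> nn x y; have fn := (middle_nucleus_f n).1 nn.
have [x' <-] := rdivP (f n) x.
by rewrite fn ls_fh nn -(ls_f_addl n) -fn.
Qed.

Lemma h_middle_nucleusC n u x : middle_nucleus n ->
  h u + (n + x) = n + (h u + x).
Proof.
move=> nn; have [f' fK f'K] := ls_bij H.
rewrite -{1}(f'K n) (@ls_swap _ _ _ (h u + x)) ?f'K //.
by rewrite -asc_f f'K; move/middle_nucleusE: nn => ->.
Qed.

(** Since [h Q] commutes with a middle nuclear [n], translations by [h n] and
    [h u] compose well on the other side; as [asc] does not see [h], the same
    holds for [n] and [u]. *)
Lemma middle_left_nucleus n : middle_nucleus n -> left_nucleus n.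
Proof.
move=> nn; apply/left_nucleusE => u y; rewrite -asc_h; apply: ascP.
have hn := middle_nucleus_h nn.
have hC : h n + h u = h u + h n.
  by have := h_middle_nucleusC u 0 hn; rewrite !laddr0.
by rewrite hC hn h_middle_nucleusC.
Qed.

End LeftSplitting.

(** * Both F-laws *)

Section Opposite.
Variable Q : loopType.
Implicit Types n k : Q.

Lemma op_middle_nucleus n :
  @middle_nucleus (oploop Q) n <-> middle_nucleus n.
Proof. by split=> nn x y; apply/esym/nn. Qed.

Lemma op_left_nucleus n : @left_nucleus (oploop Q) n <-> right_nucleus n.
Proof. by split=> nn x y; apply/esym/nn. Qed.

Lemma op_nucleus n : @nucleus (oploop Q) n <-> nucleus n.
Proof.
by split=> nn x y; case: (nn y x).
Qed.
End Opposite.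

(** Both laws together; the first summands [f p] and [k p] of [p] in the two
    laws agree up to the nucleus. *)
Record splitting (Q : loopType) (f g h k : Q -> Q) : Prop := Splitting {
  sp_left : left_splitting f h;
  sp_right : @left_splitting (oploop Q) g k;
  sp_comm : forall x, f (g x) = g (f x);
  sp_theta : forall x, exists2 n : Q, nucleus n & f x = k x + n }.

Section FromAutotopism.
Variables (Q : loopType) (f g h k : Q -> Q).
Implicit Types n x y : Q.
Hypothesis L : left_splitting f h.
Hypothesis R : @left_splitting (oploop Q) g k.
Hypothesis fgC : forall x, f (g x) = g (f x).
Hypothesis E :
  forall z, exists V : Q -> Q, forall p q, (p + f (h z)) + V q = (p + q) + h z.

Let B q x y : (x + k q) + (y + g q) = (x + y) + q.
Proof. by have := ls_split R q y x. Qed.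

Let gD : {morph g : x y / x + y}.
Proof. by move=> x y; have := ls_morph R y x. Qed.

Lemma h_g_comm x : h (g x) = g (h x).
Proof. by apply: (@laddI _ (f (g x))); rewrite (ls_fh L) fgC -gD (ls_fh L). Qed.

Let kg x : k x + g x = x.
Proof. exact: (ls_fh R). Qed.

Lemma h_k_comm x : h (k x) = k (h x).
Proof.
by apply: (@laddrI _ (g (h x))); rewrite kg -h_g_comm -(ls_hD L) kg.
Qed.

Lemma f_h_comm x : f (h x) = h (f x).
Proof.
by apply: (@laddI _ (f (f x))); rewrite -(ls_morph L) !(ls_fh L).
Qed.

Lemma middle_nucleus_nucleus n : middle_nucleus n -> nucleus n.
Proof.
move=> nn; apply/nucleusP; split=> //; first exact: (middle_left_nucleus L).
apply/op_left_nucleus; apply: (middle_left_nucleus R).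
exact/op_middle_nucleus.
Qed.

(** For [h x] instead of [x]: by [E] and by the second law the right
    translation by [h x] is the third component of two autotopisms, whose
    quotient is a nuclear autotopism carrying [k (h x)] to [f (h x)]. Since [asc]
    does not see [h], the conclusion descends to [x]. *)
Lemma theta_nucleus x : exists2 n : Q, nucleus n & f x = k x + n.
Proof.
exists (ldiv (k x) (f x)); last by rewrite addldiv.
apply: middle_nucleus_nucleus; apply: (middle_nucleus_hP L).
set n := h _; have [V VE] := E x.
have nE : f (h x) = k (h x) + n by rewrite /n -h_k_comm -(ls_hD L) addldiv f_h_comm.
have key p q : (p + k (h x)) + (q + g (h x)) = (p + f (h x)) + V q.
  by rewrite B VE.
have [p0 p0E] := rdivP (k (h x)) 0.
have q0 q : q + g (h x) = (p0 + f (h x)) + V q by rewrite -key p0E ladd0.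
have V0 Y : exists q, V q = Y.
  have [q qE] := rdivP (g (h x)) ((p0 + f (h x)) + Y).
  by exists q; apply: laddI (etrans (esym (q0 q)) qE).
have nE' p : (p + k (h x)) + (p0 + f (h x)) = p + f (h x).
  by have [q qE] := V0 0; have := key p q; rewrite q0 qE !laddr0.
have p0n : p0 + f (h x) = n.
  by apply: (@laddI _ (k (h x))); rewrite -nE -[k _ in LHS]ladd0 nE' ladd0.
move=> X Y; have [p <-] := rdivP (k (h x)) X; have [q <-] := V0 Y.
by rewrite -p0n nE' -key q0.
Qed.

Lemma splitting_from_autotopism : splitting f g h k.
Proof. by split=> // x; exact: theta_nucleus. Qed.
End FromAutotopism.

(** The hypothesis passes to the opposite loop with [f], [g] and [h], [k]
    exchanged ([splitting_op]), so that every statement has a mirror image. *)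
Section SplittingTheory.
Variables (Q : loopType) (f g h k : Q -> Q).
Hypothesis S : splitting f g h k.
Implicit Types u w x y n : Q.

Let L := sp_left S.
Let R := sp_right S.

Let B q x y : (x + k q) + (y + g q) = (x + y) + q.
Proof. by have := ls_split R q y x. Qed.

Let gD : {morph g : x y / x + y}.
Proof. by move=> x y; have := ls_morph R y x. Qed.

Let kg x : k x + g x = x.
Proof. exact: (ls_fh R). Qed.

Lemma sp_nucleus n : middle_nucleus n -> nucleus n.
Proof. exact: (middle_nucleus_nucleus L R). Qed.

Lemma sp_hnC n u : nucleus n -> n + h u = h u + n.
Proof.
move=> nn; have := h_middle_nucleusC L u 0 (nucm nn).
by rewrite !laddr0.
Qed.

Lemma sp_theta_g x n : f x = k x + n -> nucleus n -> g x = h x + n.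
Proof.
move=> fE nn; rewrite -sp_hnC //; apply: (@laddI _ (k x)).
by rewrite kg -(nucm nn) -fE (ls_fh L).
Qed.

Lemma asc_nucleus u w n : nucleus n -> asc u w n = n.
Proof. by move=> nn; apply: ascP; rewrite (nucr nn). Qed.

Lemma asc_nuclear_r u w n x : nucleus n -> asc u (w + n) x = asc u w x.
Proof.
move=> nn; apply: ascP.
rewrite [in RHS](nucm nn) -(ascE u w (n + x)) (ascD L) (asc_nucleus _ _ nn).
by rewrite -[RHS](nucm nn) (nucr nn).
Qed.

Lemma asc_nuclear_l u w n x : nucleus n -> asc (u + n) (h w) x = asc u (h w) x.
Proof.
move=> nn; apply: ascP; rewrite -(asc_nuclear_r _ _ _ nn) 2!(nucm nn).
by rewrite -(nucl nn) sp_hnC // ascE.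
Qed.

Lemma asc_g u w x : asc (g u) (g w) x = asc u w x.
Proof.
have [n nn fu] := sp_theta S u; have [m mm fw] := sp_theta S w.
rewrite (sp_theta_g fu nn) (sp_theta_g fw mm) asc_nuclear_r //.
by rewrite asc_nuclear_l // (asc_h L).
Qed.

(** The two readings of [x + q], through [k q + g q = q] and through
    [(x + k q) + g q], show that [asc x (k q)] fixes [g q]; up to the nucleus
    [k] is [f], and [asc] does not see the automorphisms [f] and [g]. *)
Lemma asc_fix_r x q : asc x q q = q.
Proof.
have [f' fK f'K] := ls_bij L.
have [n nn fq] := sp_theta S q.
have fix_gq : asc (f x) (k q) (g q) = g q.
  by apply: ascP; rewrite kg; have := B q (f x) 0; rewrite laddr0 ladd0.
rewrite -(asc_nuclear_r _ _ _ nn) -fq (asc_f L) in fix_gq.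
have [g' gK g'K] := ls_bij R.
by apply: (can_inj gK); rewrite (asc_morph _ _ _ gD) asc_g.
Qed.

Lemma right_alternative x q : x + (q + q) = (x + q) + q.
Proof. by rewrite -ascE asc_fix_r. Qed.

End SplittingTheory.

Lemma splitting_op (Q : loopType) (f g h k : Q -> Q) :
  splitting f g h k -> @splitting (oploop Q) g f k h.
Proof.
move=> S; have [L R fgC th] := S; split=> // [|x].
  by split; [exact: (ls_morph L) | exact: (ls_bij L) | exact: (ls_split L)].
have [n nn fx] := th x; exists n; first exact/op_nucleus.
by rewrite (sp_theta_g S fx nn) -(sp_hnC S).
Qed.

Section SplittingTheory2.
Variables (Q : loopType) (f g h k : Q -> Q).
Hypothesis S : splitting f g h k.
Implicit Types u w x y n p : Q.

Let L := sp_left S.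
Let R := sp_right S.

Lemma left_alternative x q : (q + q) + x = q + (q + x).
Proof. exact: (right_alternative (splitting_op S) x q). Qed.

Lemma asc_diag x y : asc x x y = y.
Proof. by apply: ascP; rewrite left_alternative. Qed.

(** As [asc p p] is trivial, the left translations by [h p] and [f p] commute. *)
Lemma sp_hC p x : h p + x = x + h p.
Proof.
have [y <-] := ldivP (f p) x.
by rewrite (ls_f_addr L) (ls_swap L (asc_diag p _)) (ls_f_addl L).
Qed.
End SplittingTheory2.

(** * Nucleus and Moufang center *)

Section MoufangCenter.
Variable Q : loopType.
Implicit Types k l n x y z : Q.

Lemma mc_comm k x : moufang_center k -> k + x = x + k.
Proof.
move=> kk; have [y <-] := ldivP k x.
by have := kk 0 y; have := kk y 0; rewrite !ladd0 !laddr0 => -> ->.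
Qed.

Lemma mc_double k x : moufang_center k -> (k + k) + x = k + (k + x).
Proof. by move=> kk; have := kk 0 x; rewrite ladd0 laddr0. Qed.

Lemma mc_doubled k : moufang_center k -> moufang_center (k + k).
Proof.
move=> kk.
have dd z : ((k + k) + (k + k)) + z = (k + k) + ((k + k) + z).
  have [z1 <-] := ldivP k z; have [z2 <-] := ldivP k z1.
  rewrite [X in X + _ = _]mc_double // -(kk (k + (k + k))) -(kk (k + k)).
  by rewrite -(mc_double z2 kk).
by move=> x y; rewrite dd !mc_double // -!kk !mc_double.
Qed.

Lemma mc_add k l : moufang_center k -> moufang_center l ->
  moufang_center (k + l).
Proof.
move=> kk ll x y; have kk2 := mc_doubled kk.
have e z : (k + l) + (k + z) = (k + k) + (l + z) by rewrite kk.
have [x1 <-] := ldivP k x; have [y1 <-] := ldivP k y.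
by rewrite -(kk x1 y1) (e l) (e x1) (e y1) -!kk2 ll.
Qed.

Lemma mc_oppK k x : moufang_center k -> k + (loop_opp k + x) = x.
Proof.
move=> kk; apply: (@laddI _ k); rewrite -mc_double // kk.
by rewrite loop_addN ladd0.
Qed.

Lemma mc_opp k : moufang_center k -> moufang_center (loop_opp k).
Proof.
move=> kk.
have Kk x : loop_opp k + (k + x) = x.
  by apply: (@laddI _ k); rewrite mc_oppK.
have dd z : (loop_opp k + loop_opp k) + z = loop_opp k + (loop_opp k + z).
  have [z1 <-] := ldivP k z; have [z2 <-] := ldivP k z1.
  rewrite !Kk; apply: (@laddI _ (k + k)); rewrite kk.
  by rewrite [k + (_ + _)]mc_oppK // Kk mc_double.
move=> x y; have [x1 <-] := ldivP k x; have [y1 <-] := ldivP k y.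
by rewrite dd -kk mc_double // !Kk.
Qed.

Lemma op_moufang_center k : moufang_center k -> @moufang_center (oploop Q) k.
Proof.
move=> kk; suff e x y : (y + x) + (k + k) = (y + k) + (x + k) by [].
by rewrite -(mc_comm _ (mc_doubled kk)) -(mc_comm y kk) -(mc_comm x kk) kk.
Qed.

Lemma mc_left_nucleus k : moufang_center k -> left_nucleus k -> nucleus k.
Proof.
move=> kk nl.
have e x y : x + (k + y) = k + (x + y).
  by apply: (@laddI _ k); rewrite -nl -kk mc_double.
apply/nucleusP; split=> // x y.
  by rewrite -(mc_comm x kk) nl e.
by rewrite -(mc_comm y kk) -(mc_comm _ kk) e.
Qed.

Lemma nuc0 : nucleus (0 : Q).
Proof. by move=> x y; rewrite !ladd0 !laddr0. Qed.

Lemma nuc_add n m : nucleus n -> nucleus m -> nucleus (n + m).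
Proof.
move=> nn mm; apply/nucleusP; split=> x y.
- by rewrite (nucl nn) (nucl nn) (nucl mm) (nucl nn).
- by rewrite -(nucr mm) (nucm mm) (nucm nn) (nucl nn).
- by rewrite -!(nucr mm) (nucr nn).
Qed.

Lemma nuc_addNl n : nucleus n -> loop_opp n + n = 0.
Proof.
move=> nn; apply: (@laddI _ n); rewrite -(nucl nn) loop_addN.
by rewrite ladd0 laddr0.
Qed.

Lemma nuc_oppK n x : nucleus n -> n + (loop_opp n + x) = x.
Proof. by move=> nn; rewrite -(nucl nn) loop_addN ladd0. Qed.

Lemma nuc_opp n : nucleus n -> nucleus (loop_opp n).
Proof.
move=> nn; have Kn x : loop_opp n + (n + x) = x.
  by rewrite -(nucm nn) nuc_addNl // ladd0.
have nK x : (x + loop_opp n) + n = x.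
  by rewrite (nucr nn) nuc_addNl // laddr0.
have Kr x : (x + n) + loop_opp n = x.
  by rewrite (nucm nn) loop_addN laddr0.
apply/nucleusP; split=> x y.
- by apply: (@laddI _ n); rewrite -(nucl nn) !nuc_oppK.
- have [x1 <-] := rdivP n x; have [y1 <-] := ldivP n y.
  by rewrite Kr Kn (nucm nn) -(nucm nn).
- by apply: (@laddrI _ n); rewrite nK (nucr nn) nK.
Qed.

End MoufangCenter.

Section Transport.
Variables (Q : loopType) (f : Q -> Q).
Hypothesis fD : {morph f : x y / x + y}.
Hypothesis f_bij : bijective f.

Lemma nuc_morph n : nucleus n -> nucleus (f n).
Proof.
have [f' fK f'K] := f_bij; move=> nn x y.
rewrite -(f'K x) -(f'K y) -!fD.
by case: (nn (f' x) (f' y)) => -> -> ->.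
Qed.

Lemma mc_morph k : moufang_center k -> moufang_center (f k).
Proof.
by have [f' fK f'K] := f_bij; move=> kk x y; rewrite -(f'K x) -(f'K y) -!fD kk.
Qed.
End Transport.

(** * The NK-decomposition *)

Section SplittingNK.
Variables (Q : loopType) (f g h k : Q -> Q).
Hypothesis S : splitting f g h k.
Implicit Types u w x y n p : Q.

Let L := sp_left S.
Let R := sp_right S.
Let fD := ls_morph L.
Let hD := ls_hD L.
Let hC := sp_hC S.

Lemma sp_decomposition x : exists w n, nucleus n /\ x = h w + n.
Proof.
have [g' gK g'K] := ls_bij R; have [n nn fE] := sp_theta S (g' x).
by exists (g' x), n; split=> //; rewrite -(sp_theta_g S fE nn) g'K.
Qed.

Lemma sp_shuffle x w n m : nucleus n -> nucleus m ->
  (x + n) + (h w + m) = (x + h w) + (n + m).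
Proof.
move=> nn mm.
rewrite (nucm nn) -(nucl nn) (sp_hnC S w nn) (nucr mm).
by rewrite -(nucr (nuc_add nn mm)).
Qed.

(** The elements of [h Q] commute, so that for them the law is symmetric; the
    nuclear parts of [x] and [y] can be moved out of the way. *)
Lemma ls_split_swap q x y : (h (h q) + x) + (f (h q) + y) = h q + (x + y).
Proof.
have [u [n [nn ->]]] := sp_decomposition x.
have [w [m [mm ->]]] := sp_decomposition y.
have nm := nuc_add nn mm.
rewrite -(nucr nn) -(nucr mm) (f_h_comm L) -!hD !sp_shuffle // -[RHS](nucr nm).
congr (_ + _); rewrite hC !hD -(f_h_comm L) -(ls_split L) ; congr (_ + _).
exact: hC.
Qed.

(** On [h Q] the two summands [f p] and [h p] of [p] differ by a central
    element, because [ls_split] holds with the roles of [f] and [h] exchanged;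
    so there [p] is [f p + f p] up to a central element, and [ls_split] becomes
    the Moufang law. *)
Lemma sp_half q : exists m, [/\ nucleus m, forall x, m + x = x + m &
  forall y, h (h q) + y = m + (f (h q) + y)].
Proof.
set t := ldiv (f q) 0.
have tE : f (h q) + h t = 0 by rewrite (f_h_comm L) -hD addldiv (ls_h0 L).
pose m := h (h q) + h t.
have mC x : m + x = x + m by rewrite /m -hD hC.
have hE y : h (h q) + y = m + (f (h q) + y).
  by rewrite /m ls_split_swap (ls_split L) tE ladd0.
exists m; split=> //; apply: (sp_nucleus S) => X Y.
have [x <-] := ldivP (f (h q)) X; have [y <-] := ldivP (f (h q)) Y.
by rewrite -mC -!hE (ls_split_swap) (ls_split L).
Qed.

Lemma sp_moufang_h q : moufang_center (h q).
Proof.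
have [f' fK f'K] := ls_bij L.
rewrite -(f'K q) -(f_h_comm L); have [m [mm mC hE]] := sp_half (f' q).
set p := h (f' q) in hE *.
have e x y : p + (x + y) = m + ((f p + x) + (f p + y)).
  by rewrite (ls_split L) hE -(nucm mm) -mC (nucl mm).
move=> x y; apply: (@laddI _ m); rewrite -e -(nucl mm).
by have := e 0 0; rewrite !laddr0 => <-.
Qed.

(** The component of [e] in the Moufang center is again left nuclear, and there
    the Moufang law turns left nuclear elements into nuclear ones. *)
Lemma sp_left_nucleus (e : Q) : left_nucleus e -> nucleus e.
Proof.
have [w [n [nn ->]]] := sp_decomposition e => ne.
apply: nuc_add => //; apply: mc_left_nucleus; first exact: sp_moufang_h.
move=> x y; have [x1 <-] := ldivP n x.
by rewrite (nucl nn) -!(nucm nn) ne.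
Qed.

End SplittingNK.

(** * F-quasigroups as isotopes of loops *)

Section QuasigroupBasics.
Variable Q : quasigroupType.
Implicit Types x y z : Q.
Local Open Scope group_scope.

Lemma qmulI x y z : x * y = x * z -> y = z.
Proof.
move=> e; have [t [_ tU]] := (@mulg_divisible Q).1 x (x * z).
by rewrite -(tU _ e) -(tU z erefl).
Qed.

Lemma qmulrI x y z : y * x = z * x -> y = z.
Proof.
move=> e; have [t [_ tU]] := (@mulg_divisible Q).2 x (z * x).
by rewrite -(tU _ e) -(tU z erefl).
Qed.

Definition qldiv x y : Q := sval (cid ((@mulg_divisible Q).1 x y)).
Definition qrdiv y x : Q := sval (cid ((@mulg_divisible Q).2 x y)).

Lemma mulqldiv x y : x * qldiv x y = y.
Proof. by rewrite /qldiv; case: cid => z []. Qed.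

Lemma mulqrdiv y x : qrdiv y x * x = y.
Proof. by rewrite /qrdiv; case: cid => z []. Qed.

Lemma qldivK x y : qldiv x (x * y) = y.
Proof. by apply: (@qmulI x); rewrite mulqldiv. Qed.

Lemma qrdivK y x : qrdiv (y * x) x = y.
Proof. by apply: (@qmulrI x); rewrite mulqrdiv. Qed.

Lemma alphaP x y : x * y = x -> y = alpha x.
Proof. by move=> e; apply: (@qmulI x); rewrite mulg_alpha. Qed.

Lemma betaP x y : y * x = x -> y = beta x.
Proof. by move=> e; apply: (@qmulrI x); rewrite mulg_beta. Qed.

End QuasigroupBasics.

Section FQuasigroupTheory.
Variable Q : fquasigroupType.
Implicit Types x y z w : Q.
Local Open Scope group_scope.

Let Fl := @mulg_Fl Q.
Let Fr := @mulg_Fr Q.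

Lemma alphaM : {morph @alpha Q : x y / x * y}.
Proof. by move=> x y; apply/esym/alphaP; rewrite -Fl mulg_alpha. Qed.

Lemma betaM : {morph @beta Q : x y / x * y}.
Proof. by move=> x y; apply/esym/betaP; rewrite -Fr mulg_beta. Qed.

Lemma beta_alpha_mulA x y : beta x * (y * alpha x) = (beta x * y) * alpha x.
Proof. by rewrite Fl -alphaM mulg_beta. Qed.

(** Expanding [x (yw . z)] by both laws in the two possible orders, and then
    cancelling the common factor [z]. *)
Lemma mul_alphar x y w :
  (y * w) * alpha x = (y * alpha x) * (w * alpha (alpha x)).
Proof.
have key z y0 w0 : (y0 * (alpha x * beta z)) * (w0 * (alpha (alpha x) * z)) =
    (y0 * (beta (alpha x) * beta z)) * (w0 * (alpha x * z)).
  rewrite -(mulqldiv x y0) -(mulqldiv (alpha x) w0).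
  set u := qldiv x y0; set v := qldiv (alpha x) w0.
  by rewrite -!Fl -betaM -!Fr -!Fl.
apply: (@qmulrI _ x).
rewrite [y * w * _]Fr (Fr x _ (y * _)) (Fr (beta x) _ y) (Fr x _ w) -key.
by rewrite -(Fr (beta x) _ y) -(Fr x _ w) -Fr.
Qed.

End FQuasigroupTheory.

(** The principal isotope of an F-quasigroup in which the translations by
    [alpha a] and [beta a] are automorphisms and [a] is the neutral element. *)
Definition aloop (Q : fquasigroupType) (a : Q) : Type := Q.

Section PointedIsotope.
Variables (Q : fquasigroupType) (a : Q).
Local Notation mul := (@monoid.mul Q).
Local Notation "x ** y" := (mul x y) (at level 40, left associativity).
Local Notation b := (beta a).
Local Notation c := (alpha a).
Local Notation P := (aloop a).
Implicit Types x y z p q : Q.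

Let aadd (x y : P) : P := qrdiv (x : Q) c ** qldiv a (y : Q).

HB.instance Definition _ := Algebra.hasAdd.Build P aadd.
HB.instance Definition _ := Algebra.hasZero.Build P a.

Lemma aaddE x y : (x ** c : P) + (a ** y : P) = x ** y :> P.
Proof. by rewrite /Algebra.add /= /aadd qrdivK qldivK. Qed.

Lemma aloop_elim_r (Pr : P -> Prop) : (forall x : Q, Pr (x ** c)) -> forall x, Pr x.
Proof. by move=> h x; rewrite -[x](mulqrdiv _ c); apply: h. Qed.

Lemma aloop_elim_l (Pr : P -> Prop) : (forall x : Q, Pr (a ** x)) -> forall x, Pr x.
Proof. by move=> h x; rewrite -[x](mulqldiv a); apply: h. Qed.

Let add0 : left_id (0 : P) +%R.
Proof.
by elim/aloop_elim_l => x; have := aaddE a x; rewrite mulg_alpha.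
Qed.

Let addr0 : right_id (0 : P) +%R.
Proof.
elim/aloop_elim_r => x; have := aaddE x c; rewrite mulg_alpha; exact.
Qed.

Let adiv : uniquely_divisible (@Algebra.add P).
Proof.
split=> u v.
  elim/aloop_elim_r: u => x; exists (a ** qldiv x v).
  split=> [|y]; first by rewrite aaddE mulqldiv.
  by elim/aloop_elim_l: y => y; rewrite aaddE => <-; rewrite qldivK.
elim/aloop_elim_l: u => x; exists (qrdiv v x ** c).
split=> [|y]; first by rewrite aaddE mulqrdiv.
by elim/aloop_elim_r: y => y; rewrite aaddE => <-; rewrite qrdivK.
Qed.

HB.instance Definition _ := BaseAddUMagma_isLoop.Build P add0 addr0 adiv.

Definition af (x : P) : P := (x : Q) ** c.
Definition ag (x : P) : P := b ** (x : Q).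
Definition ah (x : P) : P := a ** alpha (x : Q).
Definition ae : P := a ** a.

Let l (x : Q) : P := a ** x.
Let eps : P := b ** c.

Lemma amulE x y : (x ** y : P) = af x + l y.
Proof. exact/esym/aaddE. Qed.

Lemma ag_eps x : ag x = eps + l x.
Proof. by rewrite /ag amulE. Qed.

Lemma af_bij : bijective af.
Proof. by exists (fun x : P => qrdiv (x : Q) c) => x; [exact: qrdivK | exact: mulqrdiv]. Qed.

Lemma ag_bij : bijective ag.
Proof. by exists (fun x : P => qldiv b (x : Q)) => x; [exact: qldivK | exact: mulqldiv]. Qed.

Lemma af_ag x : af (ag x) = ag (af x).
Proof. by rewrite /af /ag beta_alpha_mulA. Qed.

Lemma afD : {morph af : x y / x + y}.
Proof.
elim/aloop_elim_r => x; elim/aloop_elim_l => y; rewrite aaddE /af.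
rewrite mul_alphar -/(af (x ** c)) amulE; congr (_ + _).
by rewrite mul_alphar mulg_alpha.
Qed.

Lemma agD : {morph ag : x y / x + y}.
Proof.
elim/aloop_elim_r => x; elim/aloop_elim_l => y; rewrite aaddE /ag.
rewrite mulg_Fl (amulE (b ** x)) /af -beta_alpha_mulA; congr (_ + _).
by rewrite /l [RHS]mulg_Fl mulg_beta.
Qed.

Lemma af_l_alpha x : af (l (alpha x)) = ah (af x).
Proof. by rewrite /af /l /ah alphaM [RHS]mulg_Fl mulg_alpha. Qed.

Let afP (p : P) : exists q, af q = p.
Proof. by exists (qrdiv (p : Q) c); exact: mulqrdiv. Qed.

Let lP (p : P) : exists q, l q = p.
Proof. by exists (qldiv a (p : Q)); exact: mulqldiv. Qed.

Lemma l_mul y z : l (y ** z) = af (l y) + l (c ** z).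
Proof. by rewrite -amulE /l mulg_Fl. Qed.

(** The left F-law for [p0 (x1 y1)], where [p = p0 c], [x = (a x1) c] and
    [y = a (c y1)]. *)
Lemma af_ah_split (p x y : P) : p + (x + y) = (af p + x) + (ah p + y).
Proof.
have [p0 <-] := afP p; have [x0 <-] := afP x; have [x1 <-] := lP x0.
have [y0 <-] := lP y; rewrite -[y0](mulqldiv c).
rewrite -l_mul -amulE mulg_Fl amulE l_mul af_l_alpha; congr (_ + _).
by rewrite amulE afD.
Qed.

Lemma aloop_left : left_splitting af ah.
Proof. by split; [exact: afD | exact: af_bij | exact: af_ah_split]. Qed.

(* [tau c] and [delta] will be mutually inverse central elements. *)
Let delta : P := l (c ** c).
Let tau (z : Q) : P := af (l (beta z)).

(* The right F-law for [(x1 y0) z], where [x = (x1 c) c] and [y = (a y0) c]. *)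
Let fr (x y : P) z : (x + tau z) + (y + l (c ** z)) = (x + y) + l z.
Proof.
have [x0 <-] := afP x; have [x1 <-] := afP x0.
have [y1 <-] := afP y; have [y0 <-] := lP y1.
by rewrite /tau -!afD -l_mul -!amulE -mulg_Fr.
Qed.

Let l_c : l c = 0.
Proof. exact: mulg_alpha. Qed.

Let fr_c (x y : P) : (x + tau c) + (y + delta) = x + y.
Proof. by rewrite fr l_c laddr0. Qed.

Let eps_lc z : eps + l (c ** z) = af eps + ag (l z).
Proof.
rewrite -ag_eps {1}/ag mulg_Fl (amulE (b ** c)); congr (_ + _).
by rewrite [RHS]mulg_Fl mulg_beta.
Qed.

Let eps_lr y : eps + l (y ** c) = af eps + af (l y).
Proof. by rewrite -ag_eps -afD -ag_eps /af /ag beta_alpha_mulA. Qed.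

Let tau_lr y : tau c + l (y ** c) = af (l y).
Proof. by rewrite /tau -amulE -mulg_Fr. Qed.

(* For [y] with [f (l y) = g (l z)], the products [c z] and [y c] agree by
   [eps_lc] and [eps_lr]; [tau_lr] and [fr_c] then identify the difference with
   the constant [delta]. *)
Let l_cM z : l (c ** z) = ag (l z) + delta.
Proof.
have [y0 yE] := afP (ag (l z)); have [y y0E] := lP y0.
have e : l (c ** z) = l (y ** c).
  by apply: (@laddI _ eps); rewrite eps_lc eps_lr y0E yE.
apply: (@laddI _ (tau c)); rewrite e tau_lr y0E yE.
by have := fr_c 0 (ag (l z)); rewrite !ladd0.
Qed.

Let tau_cC (x : P) : tau c + x = x + tau c.
Proof.
have e : (x + tau c) + delta = x by have := fr_c x 0; rewrite ladd0 laddr0.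
by have := fr_c 0 (x + tau c); rewrite !ladd0 e.
Qed.

(* By [fr_c] with [y] or [x] equal to [0], adding [delta] on the right undoes
   adding [tau c] on either side. *)
Let tau_c_nucleus : nucleus (tau c).
Proof.
have nm : middle_nucleus (tau c).
  move=> x Y; have [y <-] := rdivP delta Y; rewrite fr_c; congr (_ + _).
  by have := fr_c 0 y; rewrite !ladd0.
have nl := middle_left_nucleus aloop_left nm.
by apply/nucleusP; split=> // x y; rewrite -(tau_cC (x + y)) -nl (tau_cC x) nm (tau_cC y).
Qed.

Let tau_delta : tau c + delta = 0.
Proof. by have := fr_c 0 0; rewrite !ladd0. Qed.

Let delta_nucleus : nucleus delta.
Proof.
suff -> : delta = loop_opp (tau c) by exact: nuc_opp.
by apply: (@laddI _ (tau c)); rewrite tau_delta loop_addN.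
Qed.

Let deltaC (x : P) : delta + x = x + delta.
Proof.
apply: (@laddI _ (tau c)); rewrite -(nucl tau_c_nucleus) tau_delta ladd0.
by rewrite -(nucl tau_c_nucleus) tau_cC (nucm tau_c_nucleus) tau_delta laddr0.
Qed.

Definition ak (x : P) : P := tau (qldiv a x) + delta.

Lemma ag_ak_split (q x y : P) : (x + ak q) + (y + ag q) = (x + y) + q.
Proof.
have [z <-] := lP q; rewrite /ak /l qldivK -/(l z) -(nucr delta_nucleus).
by rewrite (nucm delta_nucleus) deltaC (nucr delta_nucleus) -l_cM fr.
Qed.

Lemma aloop_right : @left_splitting (oploop P) ag ak.
Proof.
split; [by move=> x y; apply: agD | exact: ag_bij |].
by move=> p x y; apply/esym/ag_ak_split.
Qed.

(** The additional autotopism required here is the one of [mul_alphar]. *)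
Lemma aloop_splitting : splitting af ag ah ak.
Proof.
apply: (splitting_from_autotopism aloop_left aloop_right af_ag) => z.
exists (fun q : P => l (qldiv a (qrdiv (q : Q) c) ** alpha (alpha z))) => p q.
have [p0 <-] := afP p; have [p1 <-] := afP p0.
have [q0 <-] := afP q; have [q1 <-] := lP q0.
have -> : qldiv a (qrdiv (af (l q1) : Q) c) = q1 by rewrite qrdivK qldivK.
by rewrite -!afD -[ah z]/(l (alpha z)) -!amulE mul_alphar.
Qed.

(* [asc eps x] is [asc (ah eps) (ah x)], and [ah eps] is the nuclear element
   [tau c]. *)
Let eps_nucleus : nucleus eps.
Proof.
have fE : af eps = eps + delta.
  have g0 : ag 0 = 0 by exact: mulg_beta.
  by have := eps_lc c; rewrite l_c g0 laddr0.
have hE : ah eps = tau c.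
  apply: (@laddI _ delta); rewrite deltaC [in RHS]deltaC tau_delta -deltaC.
  apply: (@laddI _ eps); rewrite -(nucm delta_nucleus) -fE.
  by rewrite (ls_fh aloop_left) laddr0.
apply: (sp_left_nucleus aloop_splitting); apply/left_nucleusE => x y.
rewrite -(asc_h aloop_left) hE; move: tau_c_nucleus => /nucl.
by move/left_nucleusE=> ->.
Qed.

Let eps_ae : eps + ae = 0.
Proof. by rewrite /ae -/(l a) -ag_eps /ag mulg_beta. Qed.

Let aeE : ae = loop_opp eps.
Proof. by apply: (@laddI _ eps); rewrite eps_ae loop_addN. Qed.

Lemma ae_nucleus : nucleus ae.
Proof. by rewrite aeE; apply: nuc_opp. Qed.

Lemma amul_linear x y : (x ** y : P) = af x + (ae + ag y).
Proof.
rewrite amulE; congr (_ + _); apply: (@laddI _ eps).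
by rewrite -(nucl eps_nucleus) eps_ae ladd0 -ag_eps.
Qed.

End PointedIsotope.

(** * NK-loops *)

Section Multiples.
Variable Q : loopType.
Implicit Types k l x y z : Q.

Lemma mc0 : moufang_center (0 : Q).
Proof. by move=> x y; rewrite !ladd0. Qed.

Lemma center0 : center (0 : Q).
Proof. by split; [exact: nuc0 | exact: mc0]. Qed.

Lemma center_add c d : center c -> center d -> center (c + d : Q).
Proof. by case=> c1 c2 [d1 d2]; split; [exact: nuc_add | exact: mc_add]. Qed.

Lemma center_opp (c : Q) : center c -> center (loop_opp c).
Proof. by case=> c1 c2; split; [exact: nuc_opp | exact: mc_opp]. Qed.

Lemma center_addA (c x y : Q) : center c -> c + (x + y) = (c + x) + y.
Proof. by case=> c1 _; rewrite (nucl c1). Qed.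

Lemma center_addCA (c x y : Q) : center c -> x + (c + y) = c + (x + y).
Proof.
by case=> c1 c2; rewrite -(nucm c1) -(mc_comm _ c2) (nucl c1).
Qed.

Lemma central_shuffle (c d x y : Q) : center c -> center d ->
  (c + x) + (d + y) = (c + d) + (x + y).
Proof.
move=> cc dd; rewrite -!center_addA //; congr (c + _); exact: center_addCA.
Qed.

Lemma mc_Kopp k x : moufang_center k -> loop_opp k + (k + x) = x.
Proof. by move=> kk; apply: (@laddI _ k); rewrite mc_oppK. Qed.

Lemma mc_addN k : moufang_center k -> loop_opp k + k = 0.
Proof. by move=> kk; rewrite -mc_comm // loop_addN. Qed.

Lemma mc_oppD k l : moufang_center k -> moufang_center l ->
  loop_opp (k + l) = loop_opp k + loop_opp l.
Proof.
move=> kk ll; have kk' := mc_opp kk; have ll' := mc_opp ll.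
apply: (@laddI _ (k + l)); rewrite loop_addN.
rewrite -(mc_oppK (loop_opp k + _) kk) -kk -(mc_double _ kk').
by rewrite -(mc_comm _ ll') mc_oppK // mc_double // !mc_oppK // loop_addN.
Qed.

Lemma mulnS k n : k *+ n.+1 = k + k *+ n.
Proof. by case: n => [|n] //; rewrite laddr0. Qed.

Lemma muln_addA k n x : moufang_center k ->
  k *+ n.+1 + x = k + (k *+ n + x).
Proof.
move=> kk; suff aux : forall z, k *+ n + (k + z) = k + (k *+ n + z).
  have [z <-] := ldivP k x; rewrite aux mulnS -kk.
  by rewrite mc_double.
elim: n => [|n IH] z; first by rewrite !ladd0.
have e t : k *+ n.+1 + t = k + (k *+ n + t).
  have [z' <-] := ldivP k t; rewrite IH mulnS -kk.
  by rewrite mc_double.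
by rewrite !e IH.
Qed.

Lemma mc_muln k n : moufang_center k -> moufang_center (k *+ n).
Proof.
move=> kk; elim: n => [|n IH]; first exact: mc0.
by rewrite mulnS; apply: mc_add.
Qed.

Lemma mc_mulz (m : int) k : moufang_center k -> moufang_center (loop_mulz m k).
Proof. by case: m => n kk; apply: mc_muln => //; apply: mc_opp. Qed.

Lemma mulzS (m : int) k x : moufang_center k ->
  loop_mulz (m + 1) k + x = k + (loop_mulz m k + x).
Proof.
move=> kk; case: m => [n | [|n]].
- by rewrite -PoszD addn1 muln_addA.
- by rewrite [Negz 0 + 1]/= /= mc_oppK // ladd0.
have -> : Negz n.+1 + 1 = Negz n by rewrite !NegzE [in LHS]intS opprD addrAC addNr add0r.
by rewrite /= [in RHS]muln_addA ?mc_oppK //; apply: mc_opp.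
Qed.

Lemma mulz_addA (m n : int) k x : moufang_center k ->
  loop_mulz m k + (loop_mulz n k + x) = loop_mulz (m + n) k + x.
Proof.
move=> kk; elim/int_rec: m => [|m IH|m IH].
- by rewrite ladd0 add0r.
- by rewrite -addn1 PoszD mulzS // IH -mulzS // addrAC.
apply: (@laddI _ k); rewrite -!mulzS // addrAC.
have -> : - (m.+1 : int) + 1 = - (m : int) by rewrite intS opprD addrAC addNr add0r.
exact: IH.
Qed.

Lemma mulz_add (m n : int) k : moufang_center k ->
  loop_mulz (m + n) k = loop_mulz m k + loop_mulz n k.
Proof. by move=> kk; have := mulz_addA m n 0 kk; rewrite !laddr0. Qed.
End Multiples.

Section NKLoopTheory.
Variable Q : nkloopType.
Implicit Types k l x y z : Q.

Lemma nk_shuffle x n k m : nucleus n -> nucleus m -> moufang_center k ->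
  (x + n) + (k + m) = (x + k) + (n + m).
Proof.
move=> nn mm kk; rewrite (nucm nn) -(nucl nn) -(mc_comm n kk) (nucr mm).
by rewrite -(nucr (nuc_add nn mm)).
Qed.

Lemma nk_oppK x y : loop_opp x + (x + y) = y.
Proof.
have [u [v [nu kv xE]]] := NK_decomposition x.
have -> : loop_opp x = loop_opp v + loop_opp u.
  apply: (@laddI _ x); rewrite loop_addN xE (nucl nu) mc_oppK //.
  by rewrite loop_addN.
have nu' := nuc_opp nu; rewrite xE (nucm nu') (nucl nu) -(nucl nu').
by rewrite nuc_addNl // ladd0 mc_Kopp.
Qed.

Lemma nk_addN x : loop_opp x + x = 0.
Proof. by have := nk_oppK x 0; rewrite !laddr0. Qed.

Lemma nk_opp_opp x : loop_opp (loop_opp x) = x.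
Proof. by apply: (@laddI _ (loop_opp x)); rewrite loop_addN nk_addN. Qed.

Lemma nk_Kopp x y : x + (loop_opp x + y) = y.
Proof. by rewrite -{1}(nk_opp_opp x) nk_oppK. Qed.

Lemma nk_left_alt x y : (x + x) + y = x + (x + y).
Proof.
have [u [v [nu kv ->]]] := NK_decomposition x.
have vu z : v + (u + z) = u + (v + z) by rewrite -(nucm nu) (mc_comm u kv) (nucl nu).
by rewrite !(nucl nu) !vu !(nucl nu) mc_double.
Qed.

Lemma nk_oppD_mc k x : moufang_center k ->
  loop_opp (k + x) = loop_opp k + loop_opp x.
Proof.
move=> kk; have kk' := mc_opp kk; apply: (@laddI _ (k + x)).
rewrite loop_addN -(mc_oppK (loop_opp k + _) kk) -kk -(mc_double _ kk').
rewrite (mc_comm _ (mc_doubled kk')) nk_Kopp.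
by rewrite mc_double // !mc_oppK // loop_addN.
Qed.

(** The Moufang law solved for one of its terms by the inverse property. *)
Lemma nk_mc_split k x z : moufang_center k ->
  (loop_opp k + x) + ((k + k) + z) = k + (x + z).
Proof.
move=> kk; rewrite -(nk_opp_opp x); set y := loop_opp x.
rewrite -nk_oppD_mc //; apply: (@laddI _ (k + y)).
by rewrite nk_Kopp -kk nk_Kopp.
Qed.

(** Combining [nk_mc_split] with the Moufang law moves [k + (k + k)] across
    any [x]. *)
Lemma mc_triple_center k : moufang_center k -> center (k + (k + k)).
Proof.
move=> kk; have kk2 := mc_doubled kk; have kk3 := mc_add kk kk2.
have e3 z : (k + (k + k)) + z = k + ((k + k) + z).
  by have [w <-] := ldivP k z; rewrite -kk !(mc_double _ kk).
have key x z : x + ((k + (k + k)) + z) = (k + (k + k)) + (x + z).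
  have := nk_mc_split (k + x) (k + z) kk.
  by rewrite !e3 mc_Kopp // -(kk x z) !(mc_double _ kk).
split=> //; apply: mc_left_nucleus => // x y.
by apply: (@laddI _ (k + (k + k))); rewrite -key -kk3 mc_double.
Qed.

Lemma mc_tripleD k l : moufang_center k -> moufang_center l ->
  (k + l) + ((k + l) + (k + l)) = (k + (k + k)) + (l + (l + l)).
Proof.
move=> kk ll; have kl := mc_add kk ll.
have [ck cl] := (mc_triple_center kk, mc_triple_center ll).
have dE (j : Q) : moufang_center j -> j + j = (j + (j + j)) + loop_opp j.
  by move=> jj; rewrite -(mc_comm _ (mc_opp jj)) mc_Kopp.
rewrite -(kk l l) {1}(dE k kk) {1}(dE l ll) (central_shuffle _ _ ck cl) -mc_oppD //.
by rewrite center_addCA ?loop_addN ?laddr0 //; apply: center_add.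
Qed.

(** Induction in steps of three, threefold multiples being central. *)
Lemma mulnD k l n : moufang_center k -> moufang_center l ->
  (k + l) *+ n = k *+ n + l *+ n.
Proof.
move=> kk ll; have kl := mc_add kk ll.
have e3 m (j : Q) : moufang_center j -> j *+ m.+3 = (j + (j + j)) + j *+ m.
  by move=> jj; rewrite -[j + (j + j)]/(j *+ 3) !muln_addA // ladd0 !mulnS.
suff [] : [/\ (k + l) *+ n = k *+ n + l *+ n,
    (k + l) *+ n.+1 = k *+ n.+1 + l *+ n.+1 &
    (k + l) *+ n.+2 = k *+ n.+2 + l *+ n.+2] by [].
elim: n => [|n [IH1 IH2 IH3]].
  by split; [rewrite ladd0 | | rewrite -[RHS]/((k + k) + (l + l)) kk].
split=> //; rewrite !e3 // mc_tripleD // IH1.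
apply/esym/central_shuffle; exact: mc_triple_center.
Qed.

Lemma mulzD (m : int) k l : moufang_center k -> moufang_center l ->
  loop_mulz m (k + l) = loop_mulz m k + loop_mulz m l.
Proof.
move=> kk ll; case: m => n /=; first exact: mulnD.
by rewrite mc_oppD // mulnD //; apply: mc_opp.
Qed.

(** As multiplication by an integer is additive on the Moufang center, sums of
    nuclear or central translates of multiples of [k] and [l] rearrange as in an
    abelian group. *)
Lemma nk_exchange k l (s t : int) n m c d :
  moufang_center k -> moufang_center l -> nucleus n -> nucleus m ->
  center c -> center d ->
  ((loop_mulz s k + n) + (loop_mulz t k + c)) +
    ((loop_mulz s l + m) + (loop_mulz t l + d)) =
  ((loop_mulz s k + n) + (loop_mulz s l + m)) +
    ((loop_mulz t k + c) + (loop_mulz t l + d)).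
Proof.
move=> kk ll nn mm cc dd; have [nc nd] := (cc.1, dd.1).
have K i := mc_mulz i kk; have Ll i := mc_mulz i ll.
have N := nuc_add.
rewrite (nk_shuffle _ nn nc (K t)) (nk_shuffle _ mm nd (Ll t)).
rewrite (nk_shuffle _ nn mm (Ll s)) (nk_shuffle _ nc nd (Ll t)).
rewrite (nk_shuffle _ (N _ _ _ nn nc) (N _ _ _ mm nd) (mc_add (Ll s) (Ll t))).
rewrite (nk_shuffle _ (N _ _ _ nn mm) (N _ _ _ nc nd) (mc_add (K t) (Ll t))).
congr (_ + _); first by rewrite -!mulz_add // -!mulzD // mulz_add //; exact: mc_add.
by rewrite !(nucl nn); congr (n + _); rewrite (center_addCA _ _ cc).
Qed.

End NKLoopTheory.

HB.instance Definition _ (Q : nkloopType) := Loop.on (oploop Q).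

Section OpNK.
Variable Q : nkloopType.

Let opNK (x : oploop Q) :
  exists u v : oploop Q, [/\ nucleus u, moufang_center v & x = u + v].
Proof.
have [u [v [nu kv xE]]] := @NK_decomposition Q x.
exists u, v; split; first exact/op_nucleus.
- exact: op_moufang_center.
- by rewrite xE; exact: esym (mc_comm u kv).
Qed.

HB.instance Definition _ := Loop_isNKLoop.Build (oploop Q) opNK.
End OpNK.

(** At [x], the map [f] is the identity on a nuclear component and the
    inversion on a component in the Moufang center, up to a central element. *)
Definition sign_decomp (Q : loopType) (f : Q -> Q) (x : Q) :=
  exists n k c : Q, [/\ nucleus n, moufang_center k, center c, x = n + k
    & f x = n + (loop_opp k + c)].

(** The remainder of [p = n + k] after [f p] is [k + k] up to a central element;
    nuclear and central terms drop out and [nk_mc_split] remains. *)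
Lemma sign_decomp_split (Q : nkloopType) (f : Q -> Q) (x y p : Q) :
  sign_decomp f p -> p + (x + y) = (f p + x) + (ldiv (f p) p + y).
Proof.
case=> n [k [c [nn kk cc -> ->]]].
have [cn cm] := cc; have cc' := center_opp cc; have kk' := mc_opp kk.
have kk2 := mc_doubled kk.
have -> : ldiv (n + (loop_opp k + c)) (n + k) = (k + k) + loop_opp c.
  apply: (@laddI _ (n + (loop_opp k + c))); rewrite addldiv (nucl nn).
  by rewrite (nk_shuffle _ cn cc'.1 kk2) loop_addN laddr0 mc_Kopp.
rewrite !(nucl nn) (nucm cn) (nucm cc'.1) nk_mc_split //.
by rewrite central_shuffle // loop_addN ladd0.
Qed.

Lemma op_sign_decomp (Q : nkloopType) (f : Q -> Q) (x : Q) :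
  sign_decomp f x -> @sign_decomp (oploop Q) f x.
Proof.
case=> n [k [c [nn kk [cn cm] xE fE]]]; have kk' := mc_opp kk.
exists n, k, c; split.
- exact/op_nucleus.
- exact: op_moufang_center.
- by split; [exact/op_nucleus | exact: op_moufang_center].
- by rewrite xE; exact: esym (mc_comm n kk).
have -> : @loop_opp (oploop Q) k = loop_opp k.
  apply: (@laddI (oploop Q) k); rewrite loop_addN; exact: esym (mc_addN kk).
rewrite fE -(mc_comm n (mc_add kk' cm)) (mc_comm c kk'); exact: erefl.
Qed.

(** The conditions on one of the two automorphisms of an arithmetic form. By
    [ar_nuc] and [ar_mc] they make it the identity on the nucleus and the
    inversion on the Moufang center, up to central elements. *)
Record arith_half (Q : nkloopType) (f : Q -> Q) : Prop := ArithHalf {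
  ar_morph : {morph f : x y / x + y};
  ar_bij : bijective f;
  ar_nucleus : forall x, nucleus (x + f x);
  ar_moufang : forall x, moufang_center (loop_opp x + f x) }.

Section ArithHalf.
Variables (Q : nkloopType) (f : Q -> Q).
Hypothesis H : arith_half f.
Implicit Types x y n k c : Q.

Lemma ar_mc k : moufang_center k ->
  exists2 c, center c & f k = loop_opp k + c.
Proof.
move=> kk; exists (k + f k); last by rewrite nk_oppK.
split; first exact: ar_nucleus.
by apply: mc_add => //; apply: mc_morph kk; [exact: ar_morph | exact: ar_bij].
Qed.

Lemma ar_nuc n : nucleus n -> exists2 c, center c & f n = n + c.
Proof.
move=> nn; exists (loop_opp n + f n); last by rewrite nk_Kopp.
split; last exact: ar_moufang.
apply: nuc_add; first exact: nuc_opp.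
by apply: nuc_morph nn; [exact: ar_morph | exact: ar_bij].
Qed.

Lemma ar_decomp x : sign_decomp f x.
Proof.
have [n [k [nn kk ->]]] := NK_decomposition x.
have [c cc fn] := ar_nuc nn; have [d dd fk] := ar_mc kk.
exists n, k, (c + d); split=> //; first exact: center_add.
by rewrite (ar_morph H) fn fk (nucl nn) -(center_addCA _ _ cc).
Qed.

Lemma ar_left_splitting : left_splitting f (fun p => ldiv (f p) p).
Proof.
split; [exact: ar_morph | exact: ar_bij |] => p x y.
by apply: sign_decomp_split; apply: ar_decomp.
Qed.

Lemma ar_right_splitting :
  @left_splitting (oploop Q) f (fun p => @ldiv (oploop Q) (f p) p).
Proof.
split; [move=> x y; exact: (ar_morph H y x) | exact: (ar_bij H) |] => p x y.
by apply: sign_decomp_split; apply: op_sign_decomp; apply: ar_decomp.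
Qed.

Lemma ar_center c : center c -> center (f c).
Proof.
by case=> c1 c2; split; [apply: nuc_morph c1 | apply: mc_morph c2];
  [exact: ar_morph | exact: ar_bij | exact: ar_morph | exact: ar_bij].
Qed.

Lemma ar_sq_mc k : moufang_center k -> exists2 c, center c & f (f k) = k + c.
Proof.
move=> kk; have [c cc fk] := ar_mc kk; have [d dd fk'] := ar_mc (mc_opp kk).
exists (d + f c); first by apply: center_add => //; apply: ar_center.
rewrite fk (ar_morph H) fk' nk_opp_opp; exact: (nucm dd.1).
Qed.

End ArithHalf.

Section ArithFromSplitting.
Variables (Q : nkloopType) (f g h k : Q -> Q).
Hypothesis S : splitting f g h k.

Let L := sp_left S.
Let R := sp_right S.

(** After splitting off a nuclear component, [x] is some [p] in [h Q]. By
    [sp_half], [p] is [f p + f p] up to a central element, so that [p + f p] is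
    a threefold multiple. The second order of summands serves the opposite
    loop. *)
Lemma splitting_nucleus (x : Q) : nucleus (x + f x) /\ nucleus (f x + x).
Proof.
have [w [n [nn ->]]] := sp_decomposition S x.
have nf : nucleus (f n) by apply: nuc_morph nn; [exact: (ls_morph L) | exact: (ls_bij L)].
have [w' <-] : exists w', f w' = w by have [f' fK f'K] := ls_bij L; exists (f' w).
set p := h (f w'); have pf : f p = h (f (f w')) by rewrite (f_h_comm L).
have kk : moufang_center p by exact: (sp_moufang_h S).
have kf : moufang_center (f p) by rewrite pf; exact: (sp_moufang_h S).
suff np : nucleus (p + f p).
  rewrite (ls_morph L) (nk_shuffle _ nn nf kf) (nk_shuffle _ nf nn kk).
  by rewrite -(mc_comm _ kk); split; apply: nuc_add => //; apply: nuc_add.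
have [m [mm mC hE]] := sp_half S (f w').
have pE : p = m + (f p + f p).
  by rewrite -{1}(ls_fh L p) -[h p]laddr0 hE laddr0 -(nucm mm) -mC (nucl mm).
rewrite {1}pE (nucl mm); apply: nuc_add => //; rewrite mc_double //.
exact: (mc_triple_center kf).1.
Qed.

Lemma mc_diff (x y l : Q) : moufang_center l -> y + l = x ->
  moufang_center (loop_opp x + y).
Proof.
move=> ll <-; suff -> : loop_opp (y + l) + y = loop_opp l by exact: mc_opp.
apply: (@laddI _ (y + l)); rewrite nk_Kopp -(mc_comm _ (mc_opp ll)).
by rewrite -(mc_comm _ ll) mc_Kopp.
Qed.

Lemma splitting_arith_left : arith_half f.
Proof.
split; [exact: (ls_morph L) | exact: (ls_bij L) | |] => x.
  exact: (splitting_nucleus x).1.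
apply: mc_diff (ls_fh L x); exact: (sp_moufang_h S).
Qed.
End ArithFromSplitting.

Lemma splitting_arith_right (Q : nkloopType) (f g h k : Q -> Q) :
  splitting f g h k -> arith_half g.
Proof.
move=> S; have R := sp_right S.
split; [by move=> x y; exact: (ls_morph R y x) | exact: (ls_bij R) | |] => x.
  by have [_ /op_nucleus] := splitting_nucleus (splitting_op S) x.
have kk := op_moufang_center (sp_moufang_h (splitting_op S) x).
apply: (mc_diff (l := k x)) => //; rewrite -mc_comm //; exact: (ls_fh R x).
Qed.

(** An arithmetic form on [Q] consists of the data making
    [f x + (e + g y)] an F-quasigroup operation. *)
Record arith_form (Q : nkloopType) (f g : Q -> Q) (e : Q) : Prop := ArithForm {
  af_left : arith_half f;
  af_right : arith_half g;
  af_comm : forall x, f (g x) = g (f x);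
  af_nucleus : nucleus e }.

Definition linear_mul (Q : loopType) (f g : Q -> Q) (e x y : Q) : Q :=
  f x + (e + g y).

(** The left F-law of an operation whose divisions are not named: [a] is the
    local right unit of [x]. *)
Definition left_F (T : Type) (m : T -> T -> T) :=
  forall x y z a, m x a = x -> m x (m y z) = m (m x y) (m a z).

(** The hypothesis on [a] reads [e + g a = h x]. Up to moving nuclear elements,
    the claim is then [ls_split] for [f x], the central difference of [f e] and
    [e] cancelling. *)
Lemma linear_mul_left_F (Q : loopType) (f g h : Q -> Q) (e : Q) :
  left_splitting f h -> {morph g : x y / x + y} ->
  (forall x, f (g x) = g (f x)) -> nucleus e ->
  (exists2 c, center c & f e = e + c) -> nucleus (g e) ->
  left_F (linear_mul f g e).
Proof.
move=> L gD fg ne [c cc fe] nge x y z a; rewrite /linear_mul => ha.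
have fD := ls_morph L; have nc := cc.1.
have {}ha : e + g a = h x by apply: (@laddI _ (f x)); rewrite ha (ls_fh L).
set T := g e + g (g z).
have -> : e + g (f y + (e + g z)) = (e + f (g y)) + T.
  by rewrite !gD fg (nucl ne).
have hc : e + g (f a) = loop_opp c + h (f x).
  apply: (@laddI _ c); rewrite nuc_oppK // -(f_h_comm L) -ha fD fe fg.
  by rewrite -(center_addCA _ _ cc) (nucl ne).
have -> : e + g (f a + (e + g z)) = loop_opp c + (h (f x) + T).
  by rewrite !gD -(nucl ne) hc (nucl (nuc_opp nc)).
rewrite !fD fe (nucl ne c) !(center_addCA _ _ cc).
rewrite (central_shuffle _ _ cc (center_opp cc)) loop_addN ladd0.
exact: (ls_split L).
Qed.

Section LinearMul.
Variables (Q : nkloopType) (f g : Q -> Q) (e : Q).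
Hypothesis H : arith_form f g e.
Local Notation mul := (linear_mul f g e).
Implicit Types x y z : Q.

Let Hf := af_left H.
Let Hg := af_right H.
Let fD := ar_morph Hf.
Let gD := ar_morph Hg.
Let ne := af_nucleus H.

Lemma linear_mul_divisible : uniquely_divisible mul.
Proof.
have [f' fK f'K] := ar_bij Hf; have [g' gK g'K] := ar_bij Hg.
split=> a b.
  exists (g' (ldiv e (ldiv (f a) b))); split.
    by rewrite /linear_mul g'K !addldiv.
  move=> y <-; apply: (can_inj gK); rewrite g'K /linear_mul.
  by apply: (@laddI _ e); apply: (@laddI _ (f a)); rewrite !addldiv.
have [x xE] := rdivP (e + g a) b.
exists (f' x); split; first by rewrite /linear_mul f'K.
move=> y yE; apply: (can_inj fK); rewrite f'K.
by apply: (@laddrI _ (e + g a)); rewrite xE -yE.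
Qed.

Lemma linear_mul_Fl : left_F mul.
Proof.
apply: (linear_mul_left_F (ar_left_splitting Hf) gD (af_comm H) ne).
  exact: ar_nuc.
by apply: nuc_morph ne => //; exact: ar_bij.
Qed.

Lemma linear_mul_Fr : left_F (fun x y => mul y x).
Proof.
have -> : (fun x y => mul y x) = @linear_mul (oploop Q) g f e.
  by apply/funext => x; apply/funext => y; exact: esym (nucm ne _ _).
apply: (linear_mul_left_F (ar_right_splitting Hg)).
- by move=> u v; apply: fD.
- by move=> u; apply/esym/(af_comm H).
- exact/op_nucleus.
- have [c [c1 c2] ge] := ar_nuc Hg ne; exists c.
    by split; [exact/op_nucleus | exact: op_moufang_center].
  by rewrite ge; exact: esym (mc_comm e c2).
- by apply/op_nucleus; apply: nuc_morph ne => //; exact: (ar_bij Hf).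
Qed.
End LinearMul.

Section LinearMulCentral.
Variables (Q : nkloopType) (f g : Q -> Q) (e : Q).
Hypothesis H : arith_form f g e.
Local Notation mul := (linear_mul f g e).
Implicit Types x y z : Q.

Let Hf := af_left H.
Let Hg := af_right H.
Let fD := ar_morph Hf.
Let gD := ar_morph Hg.
Let ne := af_nucleus H.

Let f0 : f 0 = 0.
Proof. exact: (ls_f0 (ar_left_splitting Hf)). Qed.
Let g0 : g 0 = 0.
Proof. exact: (ls_f0 (ar_left_splitting Hg)). Qed.

Lemma ar_sq (p : Q -> Q) x n k : arith_half p -> nucleus n ->
  moufang_center k -> x = n + k -> exists2 m : Q, nucleus m & p (p x) = m + k.
Proof.
move=> Hp nn kk ->; have [c [c1 c2] ppk] := ar_sq_mc Hp kk.
exists (p (p n) + c); first (apply: nuc_add => //;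
  by do 2!apply: (nuc_morph (ar_morph Hp) (ar_bij Hp))).
by rewrite !(ar_morph Hp) ppk (nucm c1) (mc_comm k c2).
Qed.

(** [f (f x)] and [g (g x)] have the same part in the Moufang center as [x],
    so together with any [y] they associate. *)
Lemma ar_sq_assoc x y : f (f x) + (y + g (g x)) = (f (f x) + y) + g (g x).
Proof.
have [n [k [nn kk xE]]] := NK_decomposition x.
have [p pp ->] := ar_sq Hf nn kk xE; have [q qq ->] := ar_sq Hg nn kk xE.
rewrite -(mc_comm q kk) -!(nucr qq); congr (_ + _).
by rewrite !(nucl pp) -(mc_comm y kk) -(mc_comm _ kk).
Qed.

(** The identity for [x = 0] makes [e] commute with everything. If [e] is
    central, then so are [f e] and [g e]; they cancel, and [ar_sq_assoc]
    remains. *)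
Lemma linear_mul_central :
  (forall x y, mul (mul x 0) (mul y x) = mul (mul x y) (mul 0 x)) <-> center e.
Proof.
have LE x y : mul (mul x 0) (mul y x) =
    (f (f x) + f e) + (e + (f (g y) + (g e + g (g x)))).
  by rewrite /linear_mul g0 laddr0 !fD !gD (af_comm H).
have RE x y : mul (mul x y) (mul 0 x) =
    (f (f x) + (f e + f (g y))) + (e + (g e + g (g x))).
  by rewrite /linear_mul f0 ladd0 !fD !gD.
have nfe : nucleus (f e) by apply: nuc_morph ne => //; exact: (ar_bij Hf).
split=> [E | ce x y].
  split=> //; have eC y : e + y = y + e.
    have [f' fK f'K] := ar_bij Hf; have [g' gK g'K] := ar_bij Hg.
    have := E 0 (g' (f' y)); rewrite LE RE g'K f'K !f0 !g0 !ladd0 !laddr0.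
    rewrite (nucl nfe) => /laddI; rewrite -(nucl ne) -(nucm ne).
    exact: laddrI.
  by move=> x y; rewrite (nucl ne e) (nucl ne x) -(nucm ne x) -eC (nucl ne x).
have [cf cg] := (ar_center Hf ce, ar_center Hg ce).
rewrite LE RE -(mc_comm _ cf.2) (center_addCA _ _ cf) -!(center_addA _ _ cf).
by rewrite !(center_addCA _ _ ce) !(center_addCA _ _ cg) ar_sq_assoc.
Qed.
End LinearMulCentral.

(** * Central endomorphisms *)

Section CentralEndo.
Variable Q : nkloopType.
Implicit Types x y n k c : Q.
Implicit Types phi psi : Q -> Q.

Lemma center_mulz (m : int) c : center c -> center (loop_mulz m c).
Proof.
have h d : center d -> forall n : nat, center (d *+ n).
  by move=> dd; elim=> [|n IH]; [exact: center0 | rewrite mulnS; exact: center_add].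
by move=> cc; case: m => n; apply: h => //; apply: center_opp.
Qed.

(** The values at one point of all central endomorphisms lie in such a set
    ([ce_near]), in which addition is that of an abelian group. *)
Definition near k x := exists (m : int) (c : Q), center c /\ x = loop_mulz m k + c.

(** Additive maps into the Moufang center which, up to the center of the loop,
    vanish on the nucleus and are multiplication by a fixed integer on the
    Moufang center. *)
Record central_endo phi : Prop := CentralEndo {
  ce_morph : {morph phi : x y / x + y};
  ce_moufang : forall x, moufang_center (phi x);
  ce_nucleus : forall n, nucleus n -> nucleus (phi n);
  ce_multiple : exists m : int,
    forall k, moufang_center k -> center (loop_mulz m k + phi k) }.

Lemma mulzNK (m : int) k x : moufang_center k ->
  loop_mulz (- m) k + (loop_mulz m k + x) = x.
Proof. by move=> kk; rewrite mulz_addA // addNr ladd0. Qed.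

Lemma ce_decomp phi : central_endo phi -> exists m : int,
  forall n k, nucleus n -> moufang_center k ->
    exists2 c, center c & phi (n + k) = loop_mulz m k + c.
Proof.
move=> P; have [m mP] := ce_multiple P; exists (- m) => n k nn kk.
exists (phi n + (loop_mulz m k + phi k)).
  apply: center_add; last exact: mP.
  by split; [exact: ce_nucleus | exact: ce_moufang].
have cn : center (phi n) by split; [exact: ce_nucleus | exact: ce_moufang].
by rewrite (ce_morph P) (center_addCA _ _ cn) mulzNK.
Qed.

Lemma ce_near x : exists2 k, moufang_center k &
  forall phi, central_endo phi -> near k (phi x).
Proof.
have [n [k [nn kk ->]]] := NK_decomposition x; exists k => // phi P.
by have [m /(_ n k nn kk) [c cc e]] := ce_decomp P; exists m, c.
Qed.

Lemma near_shift k (m : int) c x : center c ->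
  (loop_mulz m k + c) + x = loop_mulz m k + (c + x).
Proof. by case=> cn _; rewrite (nucm cn). Qed.

Lemma near_sum k (m m' : int) c c' : moufang_center k -> center c -> center c' ->
  (loop_mulz m k + c) + (loop_mulz m' k + c') = loop_mulz (m + m') k + (c + c').
Proof. by move=> kk cc cc'; rewrite near_shift // -(center_addCA _ _ cc) mulz_addA. Qed.

Lemma near_addA k x y z : moufang_center k -> near k x -> near k y ->
  (x + y) + z = x + (y + z).
Proof.
move=> kk [m [c [cc ->]]] [m' [c' [cc' ->]]].
rewrite near_sum // !near_shift //; last exact: center_add.
by rewrite -(center_addCA _ _ cc) mulz_addA // -(center_addA c' z cc).
Qed.

Definition cadd phi psi x := phi x + psi x.
Definition copp phi x := loop_opp (phi x).
Definition czero (_ : Q) : Q := 0.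

Lemma central_endo0 : central_endo czero.
Proof.
split=> [x y|x|n _|]; rewrite ?ladd0 //; [exact: mc0 | exact: nuc0 |].
by exists 0 => k _; rewrite ladd0; exact: center0.
Qed.

Lemma central_endoD phi psi :
  central_endo phi -> central_endo psi -> central_endo (cadd phi psi).
Proof.
move=> P S; split.
- move=> x y; have [n [k [nn kk ->]]] := NK_decomposition x.
  have [m [l [mm ll ->]]] := NK_decomposition y.
  have [s sP] := ce_decomp P; have [t tP] := ce_decomp S.
  have [c [cc _] e1] := sP n k nn kk; have [d [dd _] e2] := sP m l mm ll.
  have [c' cc' e3] := tP n k nn kk; have [d' dd' e4] := tP m l mm ll.
  rewrite /cadd (ce_morph P) (ce_morph S) e1 e2 e3 e4.
  by apply/esym/nk_exchange.
- by move=> x; apply: mc_add; apply: ce_moufang.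
- by move=> n nn; apply: nuc_add; apply: ce_nucleus.
have [m mP] := ce_multiple P; have [m' mP'] := ce_multiple S.
exists (m + m') => k kk; rewrite /cadd.
have e (i : int) x : x = loop_mulz (- i) k + (loop_mulz i k + x) by rewrite mulzNK.
rewrite (e m (phi k)) (e m' (psi k)) near_sum //; try by [exact: mP | exact: mP'].
by rewrite -opprD -{1}[m + m']opprK mulzNK //; apply: center_add; [exact: mP | exact: mP'].
Qed.

Lemma central_endoN phi : central_endo phi -> central_endo (copp phi).
Proof.
move=> P; split.
- move=> x y; rewrite /copp (ce_morph P) mc_oppD //; exact: ce_moufang.
- by move=> x; apply: mc_opp; apply: ce_moufang.
- by move=> n nn; apply: nuc_opp; apply: ce_nucleus.
have [m mP] := ce_multiple P; exists (- m) => k kk; rewrite /copp.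
suff -> : loop_mulz (- m) k + loop_opp (phi k) =
    loop_opp (loop_mulz m k + phi k) by apply: center_opp; exact: mP.
have mk := mc_mulz m kk; rewrite nk_oppD_mc //; congr (_ + _).
apply: (@laddI _ (loop_mulz m k)); rewrite loop_addN -mulz_add // addrN.
by [].
Qed.

Lemma ce_opp phi x : central_endo phi -> phi (loop_opp x) = loop_opp (phi x).
Proof.
move=> P; apply: (@laddI _ (phi x)); rewrite -(ce_morph P) !loop_addN.
by apply: (@laddI _ (phi 0)); rewrite -(ce_morph P) !laddr0.
Qed.

Lemma ce0 phi : central_endo phi -> phi 0 = 0.
Proof.
by move=> P; apply: (@laddI _ (phi 0)); rewrite -(ce_morph P) !laddr0.
Qed.

Lemma ce_center phi c : central_endo phi -> center c -> center (phi c).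
Proof. by move=> P [c1 c2]; split; [exact: ce_nucleus | exact: ce_moufang]. Qed.

Lemma ce_muln phi x (n : nat) : central_endo phi -> phi (x *+ n) = phi x *+ n.
Proof.
move=> P; elim: n => [|n IH]; first exact: ce0.
by rewrite !mulnS (ce_morph P) IH.
Qed.

Lemma ce_mulz phi x (m : int) : central_endo phi ->
  phi (loop_mulz m x) = loop_mulz m (phi x).
Proof. by move=> P; case: m => n /=; rewrite ce_muln // ce_opp. Qed.

Lemma mulzM (t s : int) k : moufang_center k ->
  loop_mulz t (loop_mulz s k) = loop_mulz (t * s) k.
Proof.
move=> kk; have sk := mc_mulz s kk.
elim/int_rec: t => [|t IH|t IH]; first by rewrite mul0r.
  rewrite -addn1 PoszD mulrDl mul1r (addrC (t : int)) (addrC (_ * s)).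
  by rewrite !mulz_add // IH.
apply: (@laddI _ (loop_mulz 1 (loop_mulz s k))); rewrite -mulz_add //.
have -> : 1 - (t.+1 : int) = - (t : int) by rewrite intS opprD addrA addrN add0r.
by rewrite IH [loop_mulz 1 _]/= -mulz_add // intS !mulNr mulrDl mul1r opprD addrA addrN add0r.
Qed.

Lemma central_endo_comp phi psi :
  central_endo phi -> central_endo psi -> central_endo (phi \o psi).
Proof.
move=> P S; split=> /=.
- by move=> x y /=; rewrite (ce_morph S) (ce_morph P).
- by move=> x /=; apply: ce_moufang.
- by move=> n nn /=; do 2!apply: ce_nucleus => //.
have [s sP] := ce_decomp P; have [t tP] := ce_decomp S.
exists (- (t * s)) => k kk /=; have kz j := mc_mulz j kk.
have [c cc] := tP 0 k (@nuc0 Q) kk; rewrite ladd0 => ->.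
have [d dd] := sP 0 k (@nuc0 Q) kk; rewrite ladd0 => e.
have td : center (loop_mulz t d) by apply: center_mulz.
rewrite (ce_morph P) ce_mulz // e mulzD //; last exact: dd.2.
rewrite mulzM // near_shift // mulzNK //.
by apply: center_add => //; apply: ce_center.
Qed.

(** The form in which the indeterminates act on a generalized module. *)
Definition displacement (p : Q -> Q) x := loop_opp x + p x.

Lemma displacementE p x : x + displacement p x = p x.
Proof. exact: nk_Kopp. Qed.

Lemma sign_decomp_displacement p x (n k c : Q) : nucleus n -> moufang_center k ->
  center c -> x = n + k -> p x = n + (loop_opp k + c) ->
  displacement p x = loop_mulz (- 2%:Z) k + c.
Proof.
move=> nn kk cc -> e; apply: (@laddI _ (n + k)).
rewrite displacementE e (nucl nn); congr (n + _).
rewrite -[loop_mulz _ _]/(loop_opp k + loop_opp k).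
by rewrite mc_double ?mc_oppK //; apply: mc_opp.
Qed.

Lemma displacement_central_endo p : arith_half p -> central_endo (displacement p).
Proof.
move=> H; split.
- move=> x y; apply: (@laddI _ (x + y)); rewrite displacementE (ar_morph H).
  have [n [k [c [nn kk cc xE px]]]] := ar_decomp H x.
  have [m [l [d [mm ll dd yE py]]]] := ar_decomp H y.
  rewrite -(displacementE p x) -(displacementE p y).
  rewrite (sign_decomp_displacement nn kk cc xE px).
  rewrite (sign_decomp_displacement mm ll dd yE py) xE yE.
  rewrite -(mc_comm n kk) -(mc_comm m ll) -[k in k + n]/(loop_mulz 1 k).
  by rewrite -[l in l + m]/(loop_mulz 1 l) nk_exchange.
- by move=> x; apply: ar_moufang.
- move=> n nn; apply: nuc_add; first exact: nuc_opp.
  by apply: nuc_morph nn; [exact: (ar_morph H) | exact: (ar_bij H)].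
exists 2 => k kk; rewrite mc_double // displacementE.
have [c cc ->] := ar_mc H kk.
by rewrite mc_oppK.
Qed.

Lemma arith_half_inv (p p' : Q -> Q) : arith_half p -> cancel p p' -> cancel p' p ->
  arith_half p'.
Proof.
move=> H pK p'K; split.
- by move=> x y; apply: (can_inj pK); rewrite p'K (ar_morph H) !p'K.
- by exists p.
- move=> y; rewrite -{1}(p'K y); move: (p' y) => x.
  have [n [k [nn kk ->]]] := NK_decomposition x.
  have kp : moufang_center (p k).
    by apply: mc_morph kk; [exact: (ar_morph H) | exact: (ar_bij H)].
  have np : nucleus (p n).
    by apply: nuc_morph nn; [exact: (ar_morph H) | exact: (ar_bij H)].
  rewrite (ar_morph H) -(mc_comm (p n) kp) -(mc_comm n kk) nk_shuffle //.
  apply: nuc_add; last exact: nuc_add.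
  by rewrite -mc_comm //; exact: ar_nucleus.
move=> y; rewrite -{1}(p'K y); apply: mc_diff (displacementE _ _).
by apply: ar_moufang.
Qed.

End CentralEndo.

Record arith_data := ArithData {
  ad_loop : nkloopType;
  ad_f : ad_loop -> ad_loop;
  ad_g : ad_loop -> ad_loop;
  ad_e : ad_loop;
  ad_form : arith_form ad_f ad_g ad_e }.

Section Bicommutant.
Variable A : arith_data.
Local Notation Q := (ad_loop A).
Local Notation f := (@ad_f A).
Local Notation g := (@ad_g A).

Let Hf := af_left (ad_form A).
Let Hg := af_right (ad_form A).
Let fg := af_comm (ad_form A).

Definition commuting (phi psi : Q -> Q) := forall x, phi (psi x) = psi (phi x).

(** The bicommutant of the two automorphisms inside the central endomorphisms.
    It is closed under the ring operations and its members commute with each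
    other, so that polynomials can be evaluated in it. *)
Record bicommuting (phi : Q -> Q) : Prop := Bicommuting {
  bc_endo : central_endo phi;
  bc_f : commuting phi f;
  bc_g : commuting phi g;
  bc_all : forall psi, central_endo psi -> commuting psi f -> commuting psi g ->
    commuting phi psi }.

Lemma bicommuting0 : bicommuting (@czero Q).
Proof.
split; first exact: central_endo0.
- by move=> x; rewrite /czero (ls_f0 (ar_left_splitting Hf)).
- by move=> x; rewrite /czero (ls_f0 (ar_left_splitting Hg)).
by move=> psi P _ _ x; rewrite /czero ce0.
Qed.

Lemma bicommutingD phi psi :
  bicommuting phi -> bicommuting psi -> bicommuting (cadd phi psi).
Proof.
move=> [P1 P2 P3 P4] [S1 S2 S3 S4]; split; first exact: central_endoD.
- by move=> x; rewrite /cadd P2 S2 (ar_morph Hf).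
- by move=> x; rewrite /cadd P3 S3 (ar_morph Hg).
by move=> chi C1 C2 C3 x; rewrite /cadd P4 // S4 // (ce_morph C1).
Qed.

Lemma ar_opp p x : @arith_half Q p -> p (loop_opp x) = loop_opp (p x).
Proof.
move=> H; apply: (@laddI _ (p x)); rewrite -(ar_morph H) !loop_addN.
exact: (ls_f0 (ar_left_splitting H)).
Qed.

Lemma bicommutingN phi : bicommuting phi -> bicommuting (copp phi).
Proof.
move=> [P1 P2 P3 P4]; split; first exact: central_endoN.
- by move=> x; rewrite /copp P2 (ar_opp _ Hf).
- by move=> x; rewrite /copp P3 (ar_opp _ Hg).
by move=> chi C1 C2 C3 x; rewrite /copp P4 // (ce_opp _ C1).
Qed.

Lemma bicommutingM phi psi :
  bicommuting phi -> bicommuting psi -> bicommuting (phi \o psi).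
Proof.
move=> [P1 P2 P3 P4] [S1 S2 S3 S4]; split; first exact: central_endo_comp.
- by move=> x /=; rewrite S2 P2.
- by move=> x /=; rewrite S3 P3.
by move=> chi C1 C2 C3 x /=; rewrite S4 // P4.
Qed.

Lemma bicommuting_displacement p : arith_half p -> commuting p f ->
  commuting p g ->
  (forall psi, central_endo psi -> commuting psi f -> commuting psi g ->
    commuting p psi) ->
  bicommuting (displacement p).
Proof.
move=> H pf pg pall; split; first exact: displacement_central_endo.
- by move=> x; rewrite /displacement pf (ar_morph Hf) (ar_opp _ Hf).
- by move=> x; rewrite /displacement pg (ar_morph Hg) (ar_opp _ Hg).
by move=> psi P Pf Pg x; rewrite /displacement pall // (ce_morph P) (ce_opp _ P).
Qed.

End Bicommutant.

(** * The action of the polynomial ring *)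

Record cend (A : arith_data) := Cend {
  cend_fun :> ad_loop A -> ad_loop A;
  cendP : bicommuting cend_fun }.

Lemma cend_eq (A : arith_data) (u v : cend A) : u =1 v -> u = v.
Proof.
case: u v => [u uP] [v vP] /= /funext uv; move: uP; rewrite uv => uP.
by rewrite (Prop_irrelevance uP vP).
Qed.

HB.instance Definition _ (A : arith_data) := gen_eqMixin (cend A).
HB.instance Definition _ (A : arith_data) := gen_choiceMixin (cend A).

Section Cend.
Variable A : arith_data.
Local Notation Q := (ad_loop A).
Local Notation E := (cend A).
Implicit Types u v w : E.

Let ce u : central_endo u := bc_endo (cendP u).

Definition cend0 : E := Cend (bicommuting0 A).
Definition cendD u v : E := Cend (bicommutingD (cendP u) (cendP v)).
Definition cendN u : E := Cend (bicommutingN (cendP u)).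
Definition cendM u v : E := Cend (bicommutingM (cendP u) (cendP v)).

Lemma cend_addA u v x y : (u x + v x) + y = u x + (v x + y).
Proof. by have [k kk n] := ce_near x; apply: (near_addA _ kk); apply: n. Qed.

Lemma cend_addrA : associative cendD.
Proof.
by move=> u v w; apply: cend_eq => x /=; rewrite /cadd /= /cadd cend_addA.
Qed.

Lemma cend_addrC : commutative cendD.
Proof.
by move=> u v; apply: cend_eq => x /=; rewrite /cadd mc_comm //; apply: ce_moufang (ce u) _.
Qed.

Lemma cend_add0 : left_id cend0 cendD.
Proof. by move=> u; apply: cend_eq => x /=; rewrite /cadd /= /czero ladd0. Qed.

Lemma cend_addN : left_inverse cend0 cendN cendD.
Proof. by move=> u; apply: cend_eq => x /=; rewrite /cadd /= /copp nk_addN. Qed.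

HB.instance Definition _ :=
  GRing.isZmodule.Build E cend_addrA cend_addrC cend_add0 cend_addN.

Lemma cendMA : associative cendM.
Proof. by move=> u v w; apply: cend_eq. Qed.

Lemma cendMC : commutative cendM.
Proof.
move=> u v; apply: cend_eq => x /=; have [vP vf vg _] := cendP v.
exact: (bc_all (cendP u)).
Qed.

Lemma cendMDl : left_distributive cendM +%R.
Proof. by move=> u v w; apply: cend_eq. Qed.

Lemma cendMz u v (m : int) : cendM (u *~ m) v = cendM u v *~ m.
Proof.
elim/int_rec: m => [|m IH|m IH]; first by rewrite !mulr0z; apply: cend_eq.
  by rewrite -addn1 PoszD !mulrzDr !mulr1z cendMDl IH.
rewrite -addn1 PoszD opprD !mulrzDr cendMDl IH; congr (_ + _).
by rewrite !mulrNz !mulr1z; apply: cend_eq.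
Qed.

End Cend.

(** Adjoining a unit to the commutative ring of bicommuting central
    endomorphisms makes it a target for evaluation of polynomials. *)
Lemma cendMDr (A : arith_data) (u v w : cend A) :
  cendM u (v + w) = cendM u v + cendM u w.
Proof. by rewrite cendMC cendMDl !(cendMC u). Qed.

Lemma cendMzr (A : arith_data) (u v : cend A) (m : int) :
  cendM u (v *~ m) = cendM u v *~ m.
Proof. by rewrite cendMC cendMz cendMC. Qed.

Definition unitz (A : arith_data) : Type := (int * cend A)%type.

Section Unitization.
Variable A : arith_data.
Local Notation U := (unitz A).
HB.instance Definition _ := GRing.Zmodule.copy U (int * cend A)%type.

Definition unitz1 : U := (1, 0).
Definition unitzM (u v : U) : U :=
  (u.1 * v.1, v.2 *~ u.1 + u.2 *~ v.1 + cendM u.2 v.2).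

Lemma unitz_mulC : commutative unitzM.
Proof.
by move=> u v; rewrite /unitzM mulrC [_ *~ _ + _]addrC cendMC.
Qed.

Lemma unitz_mul1 : left_id unitz1 unitzM.
Proof.
move=> [n u]; rewrite /unitzM /= mul1r mulr1z mul0rz addr0.
by rewrite -[X in _ + X](_ : 0 = cendM 0 u) ?addr0 //; apply: cend_eq.
Qed.

Lemma unitz_mulDl : left_distributive unitzM +%R.
Proof.
move=> [a u] [b v] [c w]; congr pair; rewrite /= ?mulrDl //.
rewrite mulrzDr mulrzDl cendMDl /=.
by rewrite [X in X + _ = _]addrACA; exact: addrACA.
Qed.

Lemma unitz_mulA : associative unitzM.
Proof.
move=> [a u] [b v] [c w]; congr pair; rewrite /= ?mulrA //.
rewrite ?(cendMDl, cendMDr, cendMz, cendMzr, mulrzDl, cendMA) -?mulrzA.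
rewrite (mulrC b a) (mulrC c a).
by rewrite [LHS](AC (3*1*3) (1*(2*4*6)*(3*5*7))).
Qed.

Lemma unitz_1_neq0 : unitz1 != 0 :> U.
Proof. by []. Qed.

HB.instance Definition _ := GRing.Zmodule_isComNzRing.Build U
  unitz_mulA unitz_mulC unitz_mul1 unitz_mulDl unitz_1_neq0.

Lemma unitz_sndM (u v : U) : u.1 = 0 -> v.1 = 0 -> (u * v).2 = cendM u.2 v.2.
Proof. by move=> e e'; rewrite /GRing.mul /= e e' !mulr0z !add0r. Qed.

End Unitization.

Section PolynomialAction.
Variable A : arith_data.
Local Notation Q := (ad_loop A).
Local Notation f := (@ad_f A).
Local Notation g := (@ad_g A).

Let Hf := af_left (ad_form A).
Let Hg := af_right (ad_form A).
Let fg := af_comm (ad_form A).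

(** A bijection being given only by a proposition, its inverse is recovered
    by choice. *)
Definition bij_inv (p : Q -> Q) (H : bijective p) : Q -> Q :=
  fun y => sval (cid (let: Bijective p' pK p'K := H in
                      ex_intro (fun x => p x = y) (p' y) (p'K y))).

Lemma bij_invK (p : Q -> Q) (H : bijective p) : cancel (bij_inv H) p.
Proof. by move=> y; rewrite /bij_inv; case: cid. Qed.

Lemma bij_Kinv (p : Q -> Q) (H : bijective p) : cancel p (bij_inv H).
Proof. by move=> x; apply: (bij_inj H); rewrite bij_invK. Qed.

Definition ad_f' := bij_inv (ar_bij Hf).
Definition ad_g' := bij_inv (ar_bij Hg).

Lemma inv_commuting (p : Q -> Q) (H : bijective p) (q : Q -> Q) :
  commuting q p -> commuting q (bij_inv H).
Proof. by move=> qp x; apply: (bij_inj H); rewrite -qp !bij_invK. Qed.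

Let sym (p q : Q -> Q) : commuting p q -> commuting q p.
Proof. by move=> c x; rewrite c. Qed.

Definition cendX : cend A := Cend (bicommuting_displacement Hf
  (fun x => erefl) fg (fun psi _ cf _ => sym cf)).
Definition cendY : cend A := Cend (bicommuting_displacement Hg
  (sym fg) (fun x => erefl) (fun psi _ _ cg => sym cg)).
Definition cendU : cend A := Cend (bicommuting_displacement
  (arith_half_inv Hf (bij_Kinv _) (bij_invK _))
  (sym (inv_commuting (ar_bij Hf) (fun x => erefl)))
  (sym (inv_commuting (ar_bij Hf) (sym fg)))
  (fun psi _ cf _ => sym (inv_commuting (ar_bij Hf) cf))).
Definition cendV : cend A := Cend (bicommuting_displacement
  (arith_half_inv Hg (bij_Kinv _) (bij_invK _))
  (sym (inv_commuting (ar_bij Hg) fg))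
  (sym (inv_commuting (ar_bij Hg) (fun x => erefl)))
  (fun psi _ _ cg => sym (inv_commuting (ar_bij Hg) cg))).

Definition var_value (i : 'I_4) : unitz A :=
  (0, nth 0 [:: cendX; cendY; cendU; cendV] i).

Definition peval (p : polyS) : unitz A := mmap (intmul 1 : int -> unitz A) var_value p.

Lemma pevalD : {morph peval : p q / p + q}.
Proof. by move=> p q; rewrite /peval rmorphD. Qed.

Lemma pevalM : {morph peval : p q / p * q}.
Proof. by move=> p q; rewrite /peval rmorphM. Qed.

Lemma peval_var (i : 'I_4) : peval 'X_i = var_value i.
Proof. by rewrite /peval mmapX mmap1U. Qed.

Lemma peval_ideal (p : Rring) : (peval (R_val p)).1 = 0.
Proof.
have /asboolP[a [b [c [d ->]]]] := R_valP p.
by rewrite !pevalD !pevalM !peval_var /= !mulr0 !addr0.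
Qed.

Definition pact (p : Rring) : cend A := (peval (R_val p)).2.

Lemma pactD p q : pact (p + q) = pact p + pact q.
Proof. by rewrite /pact pevalD. Qed.

Lemma pactM p q : pact (p * q)%g = cendM (pact p) (pact q).
Proof. by rewrite /pact pevalM unitz_sndM //; exact: peval_ideal. Qed.

Lemma pactE : [/\ pact Rx = cendX, pact Ry = cendY, pact Ru = cendU
  & pact Rv = cendV].
Proof. by rewrite /pact !peval_var. Qed.

End PolynomialAction.

(** The loop of an arithmetic form, as the carrier of the associated module. *)
Definition amod (A : arith_data) : Type := ad_loop A.

Section ArithModule.
Variable A : arith_data.
Local Notation M := (amod A).
Local Notation f := (@ad_f A).
Local Notation g := (@ad_g A).

HB.instance Definition _ := NKLoop.copy M (ad_loop A).

Definition ascale (p : Rring) (x : M) : M := pact A p x.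

Let ce p : central_endo (pact A p) := bc_endo (cendP _).

Lemma ascaleDr p (x y : M) : ascale p (x + y) = ascale p x + ascale p y.
Proof. exact: ce_morph (ce p) x y. Qed.

Lemma ascaleDl p q (x : M) : ascale (p + q) x = ascale p x + ascale q x.
Proof. by rewrite /ascale pactD. Qed.

Lemma ascaleA p q (x : M) : ascale p (ascale q x) = ascale (p * q)%g x.
Proof. by rewrite /ascale pactM. Qed.

Lemma ascale_moufang_center p (x : M) : moufang_center (ascale p x).
Proof. exact: ce_moufang (ce p) x. Qed.

Lemma ascale_nucleus p (z : M) : nucleus z -> nucleus (ascale p z).
Proof. exact: ce_nucleus (ce p) z. Qed.

Lemma ascale_center p (w : M) : moufang_center w ->
  exists m : int, center (loop_mulz m w + ascale p w).
Proof. by move=> ww; have [m mP] := ce_multiple (ce p); exists m; apply: mP. Qed.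

HB.instance Definition _ := NKLoop_isGModule.Build Rring M ascaleDr ascaleDl
  ascaleA ascale_moufang_center ascale_nucleus ascale_center.

Lemma ascaleE : [/\ forall x : M, Rx *> x = displacement f x,
  forall x : M, Ry *> x = displacement g x,
  forall x : M, Ru *> x = displacement (@ad_f' A) x
  & forall x : M, Rv *> x = displacement (@ad_g' A) x].
Proof.
have [eX eY eU eV] := pactE A.
split=> x; rewrite /gscale /= /ascale.
- by rewrite eX.
- by rewrite eY.
- by rewrite eU.
- by rewrite eV.
Qed.

Lemma amod_inM : inM M.
Proof.
have [eX eY eU eV] := ascaleE.
have [Hf Hg _ _] := ad_form A.
have nuc (p : ad_loop A -> ad_loop A) : arith_half p -> forall z,
    nucleus (loop_mulz 2 z + displacement p z).
  move=> H z; rewrite nk_left_alt displacementE; exact: ar_nucleus.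
have ann (p p' : ad_loop A -> ad_loop A) (a b : Rring) : arith_half p ->
    cancel p' p ->
    (forall x : M, a *> x = displacement p x) ->
    (forall x : M, b *> x = displacement p' x) -> Ann M (a + b + (a * b)%g).
  move=> H p'K ea eb x; rewrite !gscaleDl -gscaleA.
  have cA y : (a *> x + b *> x) + y = a *> x + (b *> x + y) by exact: cend_addA.
  have kx := gscale_moufang_center a x.
  have e : loop_opp (p x) + x = loop_opp (a *> x).
    apply: (@laddI _ (p x)); rewrite nk_Kopp -(mc_comm _ (mc_opp kx)).
    by rewrite -(displacementE p) -ea -(mc_comm x kx) mc_Kopp.
  rewrite cA [a *> (b *> x)]ea /displacement nk_Kopp.
  rewrite [b *> x]eb /displacement (ar_morph H) ar_opp // p'K e.
  exact: loop_addN.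
split.
- by move=> z; rewrite eX eY; split; apply: nuc.
- exact: ann Hf (bij_invK _) eX eU.
- exact: ann Hg (bij_invK _) eY eV.
Qed.

End ArithModule.

(** * Arithmetic forms of F-quasigroups and of modules *)

Section ArithmeticFormOfFQuasigroup.
Variables (Q : fquasigroupType) (a : Q).
Local Notation P := (aloop a).

Let aNK (x : P) :
  exists u v : P, [/\ nucleus u, moufang_center v & x = u + v].
Proof.
have S := aloop_splitting a; have [w [n [nn ->]]] := sp_decomposition S x.
exists n, (ah w); split=> //; first exact: (sp_moufang_h S).
by rewrite (sp_hnC S).
Qed.

HB.instance Definition _ := Loop_isNKLoop.Build P aNK.

Lemma aloop_form : arith_form (@af Q a) (@ag Q a) (ae a).
Proof.
have S := aloop_splitting a; split.
- exact: splitting_arith_left S.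
- exact: splitting_arith_right S.
- exact: af_ag.
- exact: ae_nucleus.
Qed.

Definition fq_arith : arith_data := ArithData aloop_form.

Lemma aloop_linear (x y : Q) : linear_mul (@af Q a) (@ag Q a) (ae a) x y = (x * y)%g.
Proof. exact/esym/amul_linear. Qed.

End ArithmeticFormOfFQuasigroup.

(** The loop of an arithmetic form, as the carrier of the associated
    F-quasigroup. *)
Definition aquasi (A : arith_data) : Type := ad_loop A.

Section FQuasigroupOfArithmeticForm.
Variable A : arith_data.
Local Notation T := (aquasi A).

Definition aquasi_mul : T -> T -> T := linear_mul (@ad_f A) (@ad_g A) (ad_e A).

HB.instance Definition _ := hasMul.Build T aquasi_mul.
HB.instance Definition _ :=
  Magma_isQuasigroup.Build T (linear_mul_divisible (ad_form A)).

Let Fl (x y z : T) : (x * (y * z) = (x * y) * (alpha x * z))%g.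
Proof. by apply: (linear_mul_Fl (ad_form A)); exact: (@mulg_alpha T x). Qed.

Let Fr (x y z : T) : ((z * y) * x = (z * beta x) * (y * x))%g.
Proof. by apply: (linear_mul_Fr (ad_form A)); exact: (@mulg_beta T x). Qed.

HB.instance Definition _ := Quasigroup_isFQuasigroup.Build T Fl Fr.

Lemma aquasiE (x y : T) : (x * y)%g = linear_mul (@ad_f A) (@ad_g A) (ad_e A) x y.
Proof. by []. Qed.

End FQuasigroupOfArithmeticForm.

Section ArithmeticFormOfModule.
Variable M : gmodType Rring.
Hypothesis MM : inM M.
Implicit Types x y z : M.

Lemma Rring_mulC (p q : Rring) : (p * q = q * p)%g.
Proof. by apply: val_inj; rewrite /= mulrC. Qed.

(** The integer in [gscale_center] may depend on the element, so that
    [ce_near] does not apply to all scalars; one element at a time, the same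
    argument does. *)
Lemma gscale_near z : exists n k : M, [/\ nucleus n, moufang_center k, z = n + k
  & forall p : Rring, near k (p *> z)].
Proof.
have [n [k [nn kk ->]]] := NK_decomposition z; exists n, k; split=> // p.
have [m cm] := @gscale_center _ M p k kk.
exists (- m), (p *> n + (loop_mulz m k + p *> k)).
have cn : center (p *> n).
  by split; [exact: gscale_nucleus | exact: gscale_moufang_center].
split; first exact: center_add.
by rewrite gscaleDr (center_addCA _ _ cn) mulzNK.
Qed.

Lemma gscale_addA z (p : Rring) x : (z + p *> z) + x = z + (p *> z + x).
Proof.
have [n [k [nn kk -> nk]]] := gscale_near z; rewrite !(nucl nn).
rewrite (@near_addA _ k) //; exists 1, 0; split; first exact: center0.
by rewrite laddr0.
Qed.

Lemma gscale_addA2 z (p q : Rring) x :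
  (p *> z + q *> z) + x = p *> z + (q *> z + x).
Proof.
have [n [k [nn kk zE nk]]] := gscale_near z.
by rewrite (@near_addA _ k).
Qed.

Definition gact (p : Rring) z := z + p *> z.

Lemma gact_inv (p q : Rring) : Ann M (p + q + (p * q)%g) ->
  cancel (gact q) (gact p).
Proof.
move=> an z; rewrite /gact gscaleDr gscale_addA gscaleA.
rewrite -gscale_addA2 -(mc_comm (q *> z) (gscale_moufang_center p z)).
by have := an z; rewrite !gscaleDl => ->; rewrite laddr0.
Qed.

Lemma gact_comm (p q : Rring) z : gact p (gact q z) = gact q (gact p z).
Proof.
rewrite /gact !gscaleDr !gscale_addA !gscaleA -!gscale_addA2 Rring_mulC.
by rewrite (mc_comm _ (gscale_moufang_center p z)).
Qed.

(** For [p] the integer in [gscale_center] can be taken to be 2, and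
    [z + q z] is inverse to [z + p z] by [gact_inv]. *)
Lemma gact_half (p q : Rring) :
  (forall z : M, nucleus (loop_mulz 2 z + p *> z)) ->
  Ann M (p + q + (p * q)%g) -> arith_half (gact p).
Proof.
move=> np an.
have P : central_endo (gscale p : M -> M).
  split; [exact: gscaleDr | exact: gscale_moufang_center | exact: gscale_nucleus |].
  exists 2 => k kk; split; first exact: np.
  by apply: mc_add; [exact: (mc_mulz 2 kk) | exact: gscale_moufang_center].
split.
- move=> x y; rewrite /gact gscaleDr.
  have [n [k [nn kk ->]]] := NK_decomposition x.
  have [m [l [mm ll ->]]] := NK_decomposition y.
  have [s sP] := ce_decomp P.
  have [c cc ->] := sP n k nn kk; have [d dd ->] := sP m l mm ll.
  rewrite -(mc_comm n kk) -(mc_comm m ll) -[k in k + n]/(loop_mulz 1 k).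
  by rewrite -[l in l + m]/(loop_mulz 1 l) nk_exchange.
- exists (gact q); last exact: gact_inv.
  apply: gact_inv => x; rewrite -(an x) Rring_mulC; congr (_ *> _).
  by congr (_ + _); rewrite addrC.
- move=> x; rewrite /gact -nk_left_alt; exact: np.
by move=> x; rewrite /gact nk_oppK; exact: gscale_moufang_center.
Qed.

Lemma gmod_form e : nucleus e -> arith_form (gact Rx) (gact Ry) e.
Proof.
case: MM => nxy ax ay ne; split=> //.
- by apply: (gact_half (q := Ru)) => // z; case: (nxy z).
- by apply: (gact_half (q := Rv)) => // z; case: (nxy z).
- exact: gact_comm.
Qed.

End ArithmeticFormOfModule.

(** * Linearity is tested on the generators *)

Section RringInduction.
Variable P : Rring -> Prop.
Hypotheses (PD : forall p q, P p -> P q -> P (p + q))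
  (PN : forall p, P p -> P (- p)) (PM : forall p q, P p -> P q -> P (p * q)%g)
  (PX : P Rx) (PY : P Ry) (PU : P Ru) (PV : P Rv).

Let smul (s : polyS) (p : Rring) : Rring := MkR (idealR_mull s (R_valP p)).

Let eqP (p q : Rring) : R_val p = R_val q -> P q -> P p.
Proof. by move=> /val_inj ->. Qed.

(* The ring has no unit: the property is carried from [p] to all its polynomial
   multiples, by induction on the polynomial. *)
Let Rring_smul s p : P p -> P (smul s p).
Proof.
have P0 : P 0 by rewrite -(addrN Rx); apply: PD => //; exact: PN.
pose good s0 := forall q, P q -> P (smul s0 q).
have gX (i : 'I_4) : good 'X_i.
  move=> q Pq; have [r [rE Pr]] : exists r : Rring, R_val r = 'X_i /\ P r.
    case: i => -[|[|[|[|//]]]] lt_i; [exists Rx | exists Ry | exists Ru | exists Rv];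
      by split=> //; congr 'X_ _; apply: val_inj.
  by apply: (@eqP _ (r * q)%g); [rewrite /= rE | exact: PM].
have gM s1 s2 : good s1 -> good s2 -> good (s1 * s2).
  move=> g1 g2 q Pq; apply: (@eqP _ (smul s1 (smul s2 q))); last by apply: g1; apply: g2.
  by rewrite /= mulrA.
have g1 : good 1 by move=> q Pq; apply: (@eqP _ q) => //=; rewrite mul1r.
have gm m : good 'X_[m].
  rewrite mpolyXE_id; elim/big_rec: _ => [|i x _ gx]; first exact: g1.
  apply: (gM) => //.
  elim: (m i) => [|k IH]; first by rewrite expr0.
  by rewrite exprS; exact: gM.
move: p; rewrite -/(good s); elim/mpolyind: s => [|c m s _ _ IH] q Pq.
  by apply: (@eqP _ 0) => //=; rewrite mul0r.
have Pc (n : nat) r : P r -> P (r *+ n).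
  by move=> Pr; elim: n => [|n IHn]; rewrite ?mulr0n // mulrS; apply: PD.
apply: (@eqP _ (smul 'X_[m] q *~ c + smul s q)).
  rewrite /= mulrDl; congr (_ + _).
  rewrite -scalerAl -[c in LHS]intz scaler_int.
  by apply/esym; exact: (raddfMz (\val : Rring -> polyS)).
apply: PD; last exact: IH.
case: c => n; [exact: Pc (gm _ _ Pq) | apply: PN; exact: Pc (gm _ _ Pq)].
Qed.

Lemma Rring_ind p : P p.
Proof.
have /asboolP[a [b [c [d pE]]]] := R_valP p.
apply: (@eqP _ (smul a Rx + smul b Ry + smul c Ru + smul d Rv)) => //.
by apply: PD; [apply: PD; [apply: PD|]|]; exact: Rring_smul.
Qed.
End RringInduction.

Lemma gmod_morph (M N : gmodType Rring) (u : M -> N) :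
  {morph u : x y / x + y} ->
  (forall x, u (Rx *> x) = Rx *> u x) -> (forall x, u (Ry *> x) = Ry *> u x) ->
  (forall x, u (Ru *> x) = Ru *> u x) -> (forall x, u (Rv *> x) = Rv *> u x) ->
  forall p : Rring, {morph u : x / p *> x}.
Proof.
move=> uD uX uY uU uV; apply: Rring_ind => //.
- by move=> p q Pp Pq x; rewrite !gscaleDl uD Pp Pq.
- move=> p Pp x; apply: (@laddI _ (u (p *> x))).
  have g0 (L : gmodType Rring) (z : L) : (0 : Rring) *> z = 0.
    by apply: (@laddI _ (0 *> z)); rewrite -gscaleDl !addr0 laddr0.
  rewrite -uD -gscaleDl Pp -gscaleDl addrN !g0.
  by apply: (@laddI _ (u 0)); rewrite -uD !laddr0.
by move=> p q Pp Pq x; rewrite -!gscaleA Pp Pq.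
Qed.

(** [z + q z] is inverse to [z + p z], so the action of [q] is determined by
    that of [p]. *)
Lemma gmod_inv_morph (M N : gmodType Rring) (u : M -> N) (p q : Rring) :
  {morph u : x y / x + y} -> Ann M (p + q + (p * q)%g) ->
  Ann N (p + q + (p * q)%g) ->
  (forall x, u (p *> x) = p *> u x) -> forall x, u (q *> x) = q *> u x.
Proof.
move=> uD aM aN up x.
have ann_sym (L : gmodType Rring) : Ann L (p + q + (p * q)%g) ->
    Ann L (q + p + (q * p)%g).
  by move=> an y; rewrite -(an y) Rring_mulC (addrC q).
have up' y : u (gact p y) = gact p (u y) by rewrite /gact uD up.
apply: (@laddI _ (u x)); rewrite -uD; apply: (can_inj (gact_inv (ann_sym _ aN))).
by rewrite -up' (gact_inv aM) (gact_inv aN).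
Qed.

(** * From pointed F-quasigroups to modules *)

Definition arith_of_fq (X : Fp) : arith_data := fq_arith (fq_point X).

Definition module_of_fq (X : Fp) : Mp :=
  @PointedModule (amod (arith_of_fq X)) (amod_inM _) (ad_e (arith_of_fq X)).

Definition nmodule_of_fq (X : Fp) : Mn :=
  exist _ (module_of_fq X) (af_nucleus (ad_form (arith_of_fq X))).

Section FHom.
Variables (X Y : Fp) (u : fq_hom X Y).

Let uM := fq_funM u.
Let up := fq_fun_point u.

Lemma fq_hom_alpha x : u (alpha x) = alpha (u x).
Proof. by apply: alphaP; rewrite -uM mulg_alpha. Qed.

Lemma fq_hom_beta x : u (beta x) = beta (u x).
Proof. by apply: betaP; rewrite -uM mulg_beta. Qed.

Let v : module_of_fq X -> module_of_fq Y := fun x => u (x : fq_sort X).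

Let v0 : v 0 = 0.
Proof. exact: up. Qed.

Lemma module_homD : {morph v : x y / x + y}.
Proof.
move=> x y; rewrite -[x](mulqrdiv _ (alpha (fq_point X))).
rewrite -[y](mulqldiv (fq_point X)); set x0 := qrdiv _ _; set y0 := qldiv _ _.
have -> : v (x0 * alpha (fq_point X))%g = (u x0 * alpha (fq_point Y))%g.
  by rewrite /v uM fq_hom_alpha up.
have -> : v (fq_point X * y0)%g = (fq_point Y * u y0)%g by rewrite /v uM up.
by rewrite [RHS]aaddE -uM -(aaddE (fq_point X)).
Qed.

Let v_opp x : v (loop_opp x) = loop_opp (v x).
Proof. by apply: (@laddI _ (v x)); rewrite -module_homD !loop_addN v0. Qed.

Let v_displacement (p : module_of_fq X -> module_of_fq X)
    (q : module_of_fq Y -> module_of_fq Y) :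
  (forall x, v (p x) = q (v x)) ->
  forall x, v (displacement p x) = displacement q (v x).
Proof. by move=> pq x; rewrite /displacement module_homD v_opp pq. Qed.

Lemma module_homZ (p : Rring) : {morph v : x / p *> x}.
Proof.
have [eX eY _ _] := ascaleE (arith_of_fq X); have [eX' eY' _ _] := ascaleE (arith_of_fq Y).
have [_ a1 a2] := amod_inM (arith_of_fq X); have [_ b1 b2] := amod_inM (arith_of_fq Y).
have vX x : v (Rx *> x) = Rx *> v x.
  rewrite eX eX'; apply: v_displacement => y.
  by rewrite /v /= /af uM fq_hom_alpha up.
have vY x : v (Ry *> x) = Ry *> v x.
  rewrite eY eY'; apply: v_displacement => y.
  by rewrite /v /= /ag uM fq_hom_beta up.
apply: gmod_morph => //; first exact: module_homD.
- exact: gmod_inv_morph module_homD a1 b1 vX.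
- exact: gmod_inv_morph module_homD a2 b2 vY.
Qed.

Lemma module_hom_point : v (pm_point (module_of_fq X)) = pm_point (module_of_fq Y).
Proof. by rewrite /v /= /ae uM up. Qed.

Definition module_hom : pm_hom (module_of_fq X) (module_of_fq Y) :=
  PMHom module_homD module_homZ module_hom_point.
End FHom.

Definition fq_to_module : functor Fp Mn :=
  @Functor Fp Mn nmodule_of_fq module_hom
    (fun X => pm_hom_eq (f := module_hom (fq_id X)) (g := pm_id _) erefl)
    (fun X Y Z g f => pm_hom_eq (f := module_hom (fq_comp g f))
       (g := pm_comp (module_hom g) (module_hom f)) erefl).

(** * From nuclearly pointed modules to F-quasigroups *)

Definition arith_of_module (Y : Mn) : arith_data :=
  ArithData (gmod_form (pm_inM (sval Y)) (proj2_sig Y)).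

Definition fq_of_nmodule (Y : Mn) : Fp :=
  @PointedFQuasigroup (aquasi (arith_of_module Y)) (0 : sval Y).

Section GHom.
Variables (X Y : Mn) (u : pm_hom (sval X) (sval Y)).

Let v : fq_of_nmodule X -> fq_of_nmodule Y := fun x => u (x : sval X).

Lemma fquasi_homM : {morph v : x y / (x * y)%g}.
Proof.
move=> x y; rewrite !aquasiE /v /linear_mul /= /gact.
by rewrite !(pm_funD u) !(pm_funZ u) (pm_fun_point u).
Qed.

Lemma fquasi_hom_point : v (fq_point (fq_of_nmodule X)) = fq_point (fq_of_nmodule Y).
Proof.
by apply: (@laddI _ (u 0)); rewrite -(pm_funD u) !laddr0.
Qed.

Definition fquasi_hom : fq_hom (fq_of_nmodule X) (fq_of_nmodule Y) :=
  FQHom fquasi_homM fquasi_hom_point.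
End GHom.

Definition module_to_fq : functor Mn Fp :=
  @Functor Mn Fp fq_of_nmodule fquasi_hom
    (fun X => fq_hom_eq (f := fquasi_hom (pm_id _)) (g := fq_id _) erefl)
    (fun X Y Z g f => fq_hom_eq (f := fquasi_hom (pm_comp g f))
       (g := fq_comp (fquasi_hom g) (fquasi_hom f)) erefl).

(** * The unit and counit *)

Section Unit.
Variable X : Fp.
(* The quasigroup structure depends on the proof that the point is nuclear,
   and the restricted equivalence supplies another proof than the full one. *)
Hypothesis ne : nucleus (pm_point (module_of_fq X)).
Local Notation X' := (fq_of_nmodule (exist _ (module_of_fq X) ne)).

Lemma unit_mul (x y : X) : ((x : X') * (y : X'))%g = (x * y)%g :> X.
Proof.
rewrite aquasiE -(aloop_linear (fq_point X)) /linear_mul /= /gact.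
have [eX eY _ _] := ascaleE (arith_of_fq X).
by rewrite eX eY !displacementE.
Qed.

Definition unit_map : fq_hom X' X := @FQHom X' X (fun x => x) unit_mul erefl.

Definition unit_inv : fq_hom X X' :=
  @FQHom X X' (fun x => x) (fun x y => esym (unit_mul x y)) erefl.
End Unit.

(** As [0] is the base point, [x * alpha 0 = f x] and [beta 0 * y = g y], which
    gives back the operations of the module. *)
Section Counit.
Variable Y : Mn.
Local Notation M := (sval Y).
Local Notation M' := (module_of_fq (fq_of_nmodule Y)).
Local Notation f := (gact Rx).
Local Notation g := (gact Ry).
Let e : M := pm_point M.
Let Q := fq_of_nmodule Y.
Let o : Q := fq_point Q.

Let mulE (x y : M) : ((x : Q) * (y : Q))%g = f x + (e + g y) :> M.
Proof. by []. Qed.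

Let ne : nucleus e := proj2_sig Y.
Let form := gmod_form (pm_inM M) ne.

Let f0 : f 0 = 0 :> M.
Proof. exact: (ls_f0 (ar_left_splitting (af_left form))). Qed.

Let g0 : g 0 = 0 :> M.
Proof. exact: (ls_f0 (ar_left_splitting (af_right form))). Qed.

Let mul0 (y : M) : (o * (y : Q))%g = e + g y :> M.
Proof. by rewrite mulE f0 ladd0. Qed.

Let mul_alpha0 (x : M) : ((x : Q) * alpha o)%g = f x :> M.
Proof. by rewrite mulE -mul0 mulg_alpha laddr0. Qed.

Let beta0_mul (y : M) : (beta o * (y : Q))%g = g y :> M.
Proof.
have fb : f (beta o : M) + e = 0 by have := mulg_beta o; rewrite mulE g0 laddr0.
by rewrite mulE -(nucm ne) fb ladd0.
Qed.

Lemma counit_add (x y : M) : (x : M') + (y : M') = x + y.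
Proof.
rewrite -[x](@mulqrdiv Q x (alpha o)) -[y](@mulqldiv Q o y).
by rewrite [LHS]aaddE mulE mul_alpha0 mul0.
Qed.

Let counit_gscale (p : Rring) (x y : M) : x + p *> x = y ->
  (x : M') + p *> (x : M') = y -> p *> (x : M') = p *> x.
Proof. by move=> <- e1; apply: (@laddI _ x); rewrite -counit_add. Qed.

Lemma counit_scale (p : Rring) (x : M) : p *> (x : M') = p *> x.
Proof.
have [eX eY _ _] := ascaleE (arith_of_fq (fq_of_nmodule Y)).
have [_ a1 a2] := amod_inM (arith_of_fq (fq_of_nmodule Y)); have [_ b1 b2] := pm_inM M.
pose u : M' -> M := fun x => x.
have uD : {morph u : x y / x + y} by exact: counit_add.
have eX' (z : M') : z + Rx *> z = f (u z).
  apply: etrans (mul_alpha0 z); apply: etrans (congr1 (+%R z) (eX z)) _.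
  exact: displacementE.
have eY' (z : M') : z + Ry *> z = g (u z).
  apply: etrans (beta0_mul z); apply: etrans (congr1 (+%R z) (eY z)) _.
  exact: displacementE.
have uX z : u (Rx *> z) = Rx *> u z by exact: counit_gscale (eX' z).
have uY z : u (Ry *> z) = Ry *> u z by exact: counit_gscale (eY' z).
apply: (gmod_morph uD uX uY); first exact: gmod_inv_morph uD a1 b1 uX.
exact: gmod_inv_morph uD a2 b2 uY.
Qed.

Lemma counit_point : pm_point M' = pm_point M :> M.
Proof. by rewrite /= /ae mul0 g0 laddr0. Qed.

Definition counit_map : pm_hom M' M :=
  @PMHom M' M (fun x => x) counit_add counit_scale counit_point.

Definition counit_inv : pm_hom M M' :=
  @PMHom M M' (fun x => x) (fun x y => esym (counit_add x y))
    (fun p x => esym (counit_scale p x)) (esym counit_point).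
End Counit.

Lemma fq_to_module_central (X : Fm) : centrally_pointed
  (functor_comp incl_Mn (functor_comp fq_to_module incl_Fm) X).
Proof.
case: X => X XM; apply/(linear_mul_central (ad_form (arith_of_fq X))) => x y.
rewrite !(@aloop_linear X (fq_point X)); exact: XM.
Qed.

Lemma module_to_fq_central (Y : Mc) : M_pointed (functor_comp module_to_fq incl_Mc_Mn Y).
Proof.
exact: (linear_mul_central (ad_form (arith_of_module (incl_Mc_Mn Y)))).2 (proj2_sig Y).
Qed.

Theorem mainTheorem1 :
  exists (F : functor Fp Mn) (G : functor Mn Fp),
    mutually_inverse_equivalences F G /\
    exists (FP : forall X : Fm,
              centrally_pointed
                (functor_comp incl_Mn (functor_comp F incl_Fm) X))
           (GP : forall Y : Mc,
              M_pointed (functor_comp G incl_Mc_Mn Y)),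
      mutually_inverse_equivalences
        (corestrict (functor_comp incl_Mn (functor_comp F incl_Fm)) FP)
        (corestrict (functor_comp G incl_Mc_Mn) GP).
Proof.
exists fq_to_module, module_to_fq; split.
  split.
    exists (fun X => unit_map (proj2_sig (nmodule_of_fq X))).
    split=> [X Y u | X]; first exact: fq_hom_eq.
    by exists (unit_inv (proj2_sig (nmodule_of_fq X))); split; apply: fq_hom_eq.
  exists counit_map; split=> [X Y u | Y]; first exact: pm_hom_eq.
  by exists (counit_inv Y); split; apply: pm_hom_eq.
exists fq_to_module_central, module_to_fq_central; split.
  exists (fun X => unit_map (fq_to_module_central X).1).
  split=> [X Y u | X]; first exact: fq_hom_eq.
  by exists (unit_inv (fq_to_module_central X).1); split; apply: fq_hom_eq.
exists (fun Y => counit_map (incl_Mc_Mn Y)); split=> [X Y u | Y].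
  exact: pm_hom_eq.
by exists (counit_inv (incl_Mc_Mn Y)); split; apply: pm_hom_eq.
Qed.
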